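(* Let $F$ be a finite group. Let $\eta$ be the real root of $X^3+X^2+X-2$ and let $\alpha_0=\frac{\log 2}{\log 2-\log\eta}$, so that $2=(2/\eta)^{\alpha_0}$. For any $\alpha\in[\alpha_0,1]$ there exists a sequence $\omega(\alpha)\in\{0,1,2\}^{\mathbb N}$ such that the group $\Gamma_{\omega(\alpha)}=F\wr_X G_{\omega(\alpha)}$ has logarithmic growth exponent $\alpha$, i.e. $$\lim_{r\to\infty}\frac{\log\log b_{\Gamma_{\omega(\alpha)}}(r)}{\log r}=\alpha .$$
   Context: Let $T$ be the infinite rooted binary tree, with vertices the finite words over $\{0,1\}$ and boundary $\partial T=\{0,1\}^{\mathbb N}$. The group $Aut(T)$ acts on the right, and $g\in Aut(T)$ is written $g=(g_0,g_1)\tau$ with $g_0,g_1\in Aut(T)$, $\tau\in S_2$ (permutations of $\{0,1\}$), meaning $(ty)\cdot g=\tau(t)\,(y\cdot g_t)$ for $t\in\{0,1\}$; this identifies $Aut(T)$ with $(Aut(T)\times Aut(T))\rtimes S_2$. Let $\varepsilon$ be the nontrivial element of $S_2$. For $\omega=\omega_0\omega_1\omega_2\dots\in\{0,1,2\}^{\mathbb N}$ let $\sigma\omega=\omega_1\omega_2\dots$ be the shift. The group $G_\omega=\langle a,b_\omega,c_\omega,d_\omega\rangle\le Aut(T)$ is generated by $a=(1,1)\varepsilon$ and the recursively defined $b_\omega=(u^b(\omega_0),b_{\sigma\omega})$, $c_\omega=(u^c(\omega_0),c_{\sigma\omega})$, $d_\omega=(u^d(\omega_0),d_{\sigma\omega})$,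 where $u^b(0)=u^b(1)=a$, $u^b(2)=id$; $u^c(0)=u^c(2)=a$, $u^c(1)=id$; $u^d(1)=u^d(2)=a$, $u^d(0)=id$. Let $\rho=1^\infty\in\partial T$ (fixed by $b_\omega,c_\omega,d_\omega$) and $X=\rho G_\omega$ its orbit. For a finite group $F$, $\Gamma_\omega=F\wr_X G_\omega=(\Sigma_X F)\rtimes G_\omega$, where $\Sigma_X F$ is the group of finitely supported functions $\varphi:X\to F$, $G_\omega$ acts by $(g.\varphi)(x)=\varphi(xg)$, and elements $\varphi g$ multiply by $(\varphi_1g_1)(\varphi_2g_2)=(\varphi_1(g_1.\varphi_2))(g_1g_2)$. It is a finitely generated group. For a finitely generated group $\Gamma$ with finite generating set $S$, $b_\Gamma(r)$ denotes the number of elements of word length at most $r$; the limit in the claim does not depend on $S$. *)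

(* Defs.v *)
From HB Require Import structures.
From mathcomp Require Import all_boot all_order all_algebra all_fingroup.
From mathcomp Require Import finmap.
From mathcomp Require Import all_classical all_reals all_analysis.
Import Order.TTheory GRing.Theory Num.Theory.
Import numFieldNormedType.Exports.

Set Implicit Arguments.
Unset Strict Implicit.
Unset Printing Implicit Defensive.

Local Open Scope classical_set_scope.
Local Open Scope group_scope.

(* Elements of word length at most n with respect to S, i.e. products of at
   most n elements of S or inverses of elements of S. *)
Definition word_ball (G : groupType) (S : set G) (n : nat) : set G :=
  [set g | exists s : seq G, [/\ (size s <= n)%N,
             {in s, forall x, S x \/ S x^-1} & g = \prod_(x <- s) x]].

Definition gen_set (G : groupType) (S : set G) : set G := \bigcup_n word_ball S n.

Definition generates (G : groupType) (S : {fset G}) : Prop :=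
  gen_set [set` S] = [set: G].

Lemma finite_word_ball (G : groupType) (S : set G) n :
  finite_set S -> finite_set (word_ball S n).
Proof.
move=> finS; pose T := S `|` (@monoid.inv G) @` S.
have finT : finite_set T by rewrite finite_setU; split=> //; exact: finite_image.
elim: n => [|n IH].
  apply: (@sub_finite_set _ _ [set 1]) => // g [s [+ _ ->]].
  by rewrite leqn0 size_eq0 => /eqP ->; rewrite big_nil.
apply: (@sub_finite_set _ _
  (1 |` [set x * y | x in T & y in word_ball S n])); last first.
  by rewrite finite_setU; split=> //; exact: finite_image2.
move=> g [[|x s] [ss sS ->]]; first by left; rewrite big_nil.
right; exists x; last exists (\prod_(x <- s) x).
- have [|Sx] := sS x (mem_head _ _); first by left.
  by right; exists x^-1 => //; rewrite invgK.
- by exists s; split=> // y ys; apply: sS; rewrite inE ys orbT.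
- by rewrite big_cons.
Qed.

(* [fset_set] is only meaningful on finite sets; see [finite_word_ball]. *)
Definition growth (G : groupType) (S : {fset G}) (r : nat) : nat :=
  #|` fset_set (word_ball [set` S] r)|.

Definition has_log_growth_exponent (R : realType) (G : groupType)
    (alpha : R) : Prop :=
  (exists S : {fset G}, generates S) /\
  forall S : {fset G}, generates S ->
    (fun r : nat => ln (ln (growth S r)%:R) / ln r%:R : R)%R @ \oo --> alpha.

Lemma gen_group_closed (G : groupType) (S : set G) :
  group_closed [pred g | g \in gen_set S].
Proof.
split=> [|g h]; first by rewrite !inE; exists 0%N => //; exists [::]; rewrite big_nil.
rewrite !inE => -[n _ [s [_ sS ->]]] [m _ [t [_ tS ->]]].
exists (size (s ++ rev (map (@monoid.inv G) t))) => //.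
exists (s ++ rev (map (@monoid.inv G) t)); split=> //.
  move=> x; rewrite mem_cat mem_rev => /orP[/sS //|/mapP[y /tS ty ->]].
  by rewrite invgK; case: ty; [right|left].
rewrite big_cat /=; congr (_ * _); elim: t {tS} => [|y t IH].
  by rewrite !big_nil invg1.
by rewrite big_cons invgM IH /= rev_cons -cats1 big_cat big_seq1.
Qed.

Record gen_type (G : groupType) (S : set G) := GenType {
  gen_val :> G;
  gen_valP : gen_val \in gen_set S
}.

HB.instance Definition _ (G : groupType) (S : set G) :=
  [isSub for @gen_val G S].
HB.instance Definition _ (G : groupType) (S : set G) :=
  [Choice of gen_type S by <:].
HB.instance Definition _ (G : groupType) (S : set G) :=
  SubChoice_isSubGroup.Build G _ (gen_type S) (gen_group_closed S).

Record right_action (G : groupType) := RightAction {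
  ra_sort :> Type;
  ra_act : ra_sort -> G -> ra_sort;
  ra_act1 : forall x, ra_act x 1 = x;
  ra_actM : forall x g h, ra_act x (g * h) = ra_act (ra_act x g) h
}.

Record wreath (F G : groupType) (X : right_action G) := Wreath {
  wr_fun : X -> F;
  wr_grp : G;
  wr_fin : finite_set [set x | wr_fun x <> 1]
}.

HB.instance Definition _ F G (X : right_action G) := gen_eqMixin (wreath F X).
HB.instance Definition _ F G (X : right_action G) := gen_choiceMixin (wreath F X).

Section WreathGroup.
Variables (F G : groupType) (X : right_action G).
Implicit Types u v w : wreath F X.

Lemma wreath_eq u v :
  wr_fun u = wr_fun v -> wr_grp u = wr_grp v -> u = v.
Proof.
case: u v => [f g p] [f' g' p'] /= ef eg; subst f' g'.
by congr Wreath; exact: Prop_irrelevance.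
Qed.

Lemma finite_translate (f : X -> F) (g : G) :
  finite_set [set x | f x <> 1] -> finite_set [set x | f (ra_act x g) <> 1].
Proof.
move=> fin; apply: (@sub_finite_set _ _
  ((fun x => ra_act x g^-1) @` [set x | f x <> 1])); last exact: finite_image.
by move=> x /= fx; exists (ra_act x g) => //; rewrite -ra_actM mulgV ra_act1.
Qed.

Lemma wr_one_fin : finite_set [set x : X | (1 : F) <> 1].
Proof. by apply: (@sub_finite_set _ _ set0) => // x /=. Qed.

Definition wr_one : wreath F X := Wreath 1 wr_one_fin.

Lemma wr_mul_fin u v :
  finite_set [set x | wr_fun u x * wr_fun v (ra_act x (wr_grp u)) <> 1].
Proof.
apply: (@sub_finite_set _ _ ([set x | wr_fun u x <> 1] `|`
   [set x | wr_fun v (ra_act x (wr_grp u)) <> 1])); last first.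
  by rewrite finite_setU; split; [|apply: finite_translate]; exact: wr_fin.
move=> x /= uv; have [u1|] := pselect (wr_fun u x = 1); last by left.
by right=> v1; apply: uv; rewrite u1 v1 mulg1.
Qed.

Definition wr_mul u v : wreath F X :=
  Wreath (wr_grp u * wr_grp v) (wr_mul_fin u v).

Lemma wr_inv_fin u :
  finite_set [set x | (wr_fun u (ra_act x (wr_grp u)^-1))^-1 <> 1].
Proof.
apply: (sub_finite_set _ (finite_translate (wr_grp u)^-1 (wr_fin u))).
by move=> x /= ne e; apply: ne; rewrite e invg1.
Qed.

Definition wr_inv u : wreath F X := Wreath (wr_grp u)^-1 (wr_inv_fin u).

Lemma wr_mulA : associative wr_mul.
Proof.
move=> u v w; apply: wreath_eq => /=; last exact: mulgA.
by apply/funext => x; rewrite ra_actM mulgA.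
Qed.

Lemma wr_mul1 : left_id wr_one wr_mul.
Proof.
move=> u; apply: wreath_eq => /=; last exact: mul1g.
by apply/funext => x; rewrite ra_act1 mul1g.
Qed.

Lemma wr_mulr1 : right_id wr_one wr_mul.
Proof.
move=> u; apply: wreath_eq => /=; last exact: mulg1.
by apply/funext => x; rewrite mulg1.
Qed.

Lemma wr_mulV : left_inverse wr_one wr_inv wr_mul.
Proof.
move=> u; apply: wreath_eq => /=; last exact: mulVg.
by apply/funext => x; rewrite mulVg.
Qed.

Lemma wr_mulrV : right_inverse wr_one wr_inv wr_mul.
Proof.
move=> u; apply: wreath_eq => /=; last exact: mulgV.
by apply/funext => x; rewrite -ra_actM mulgV ra_act1 mulgV.
Qed.

HB.instance Definition _ := isGroup.Build (wreath F X)
  wr_mulA wr_mul1 wr_mulr1 wr_mulV wr_mulrV.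

End WreathGroup.

(* The letters 0 and 1 are [false] and [true]; the children of the vertex w
   are [rcons w false] and [rcons w true]. *)
Record taut := TAut {
  tact :> seq bool -> seq bool;
  tact_bij : bijective tact;
  tact_nil : tact [::] = [::];
  tact_rcons : forall w t, exists t', tact (rcons w t) = rcons (tact w) t'
}.

HB.instance Definition _ := gen_eqMixin taut.
HB.instance Definition _ := gen_choiceMixin taut.

Lemma taut_eq (g h : taut) : tact g =1 tact h -> g = h.
Proof.
case: g h => [f b n r] [f' b' n' r'] /= /funext ef; subst f'.
by congr TAut; exact: Prop_irrelevance.
Qed.

Lemma size_tact (g : taut) w : size (g w) = size w.
Proof.
elim/last_ind: w => [|w t IH]; first by rewrite tact_nil.
by have [t' ->] := tact_rcons g w t; rewrite !size_rcons IH.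
Qed.

Definition taut_one : taut.
Proof.
exists (fun w => w) => //; first by exists id.
by move=> w t; exists t.
Defined.

(* Aut(T) acts on the right: w.(gh) = (w.g).h *)
Definition taut_mul (g h : taut) : taut.
Proof.
exists (fun w => h (g w)).
- exact: (bij_comp (tact_bij h) (tact_bij g)).
- by rewrite !tact_nil.
- move=> w t; have [t1 ->] := tact_rcons g w t.
  exact: tact_rcons.
Defined.

Lemma taut_inv_ex (g : taut) :
  exists h : taut, cancel (tact g) (tact h) /\ cancel (tact h) (tact g).
Proof.
have [f gK fK] := tact_bij g.
have f0 : f [::] = [::] by rewrite -{1}(tact_nil g) gK.
have fr w t : exists t', f (rcons w t) = rcons (f w) t'.
  have : size (f (rcons w t)) = (size w).+1.
    by rewrite -(size_tact g) fK size_rcons.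
  case/lastP E: (f (rcons w t)) => [//|v t'] _; exists t'.
  congr rcons; have [t1] := tact_rcons g v t'.
  by rewrite -E fK => /rcons_inj [-> _]; rewrite gK.
have bf : bijective f by exists (tact g).
by exists (TAut bf f0 fr).
Qed.

Definition taut_inv (g : taut) : taut := sval (cid (taut_inv_ex g)).

Lemma taut_mulA : associative taut_mul.
Proof. by move=> f g h; apply: taut_eq. Qed.
Lemma taut_mul1 : left_id taut_one taut_mul.
Proof. by move=> g; apply: taut_eq. Qed.
Lemma taut_mulr1 : right_id taut_one taut_mul.
Proof. by move=> g; apply: taut_eq. Qed.
Lemma taut_mulV : left_inverse taut_one taut_inv taut_mul.
Proof.
move=> g; apply: taut_eq => w /=; rewrite /taut_inv.
by case: cid => h /= [].
Qed.
Lemma taut_mulrV : right_inverse taut_one taut_inv taut_mul.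
Proof.
move=> g; apply: taut_eq => w /=; rewrite /taut_inv.
by case: cid => h /= [].
Qed.

HB.instance Definition _ := isGroup.Build taut
  taut_mulA taut_mul1 taut_mulr1 taut_mulV taut_mulrV.

(* The automorphism (g0, g1) tau. *)
Definition node_fun (g0 g1 : seq bool -> seq bool) (tau : {perm bool})
    (w : seq bool) : seq bool :=
  if w is t :: y then tau t :: (if t then g1 y else g0 y) else [::].

Lemma node_bij (g0 g1 : taut) tau : bijective (node_fun g0 g1 tau).
Proof.
have [f0 g0K f0K] := tact_bij g0; have [f1 g1K f1K] := tact_bij g1.
exists (fun w => if w is t :: y then
   let s := tau^-1%g t in s :: (if s then f1 y else f0 y) else [::]).
- by case=> [//|t y] /=; rewrite permK; case: t; rewrite ?g0K ?g1K.
- case=> [//|t y] /=; rewrite permKV.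
  by case: (tau^-1%g t); rewrite ?f0K ?f1K.
Qed.

Lemma node_rcons (g0 g1 : taut) tau w t : exists t',
  node_fun g0 g1 tau (rcons w t) = rcons (node_fun g0 g1 tau w) t'.
Proof.
case: w => [|[] y] /=; first by exists (tau t); case: t; rewrite !tact_nil.
- by have [t' ->] := tact_rcons g1 y t; exists t'.
- by have [t' ->] := tact_rcons g0 y t; exists t'.
Qed.

Definition node (g0 g1 : taut) (tau : {perm bool}) : taut :=
  @TAut (node_fun g0 g1 tau) (node_bij g0 g1 tau) erefl
        (node_rcons g0 g1 tau).

Definition wshift (omega : nat -> 'I_3) : nat -> 'I_3 := fun n => omega n.+1.

(* The automorphism x_omega given by the recursion
   x_omega = (u (omega 0), x_(wshift omega)); see [rec_autE]. *)
Fixpoint rec_fun (u : 'I_3 -> taut) (omega : nat -> 'I_3) (w : seq bool) :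
    seq bool :=
  if w is t :: y then
    t :: (if t then rec_fun u (wshift omega) y else u (omega 0%N) y)
  else [::].

Lemma rec_bij u omega : bijective (rec_fun u omega).
Proof.
pose fix f (om : nat -> 'I_3) (w : seq bool) : seq bool :=
  if w is t :: y then
    t :: (if t then f (wshift om) y else (u (om 0%N))^-1 y)
  else [::].
exists (f omega) => w; elim: w omega => [//|[] y IH] omega /=.
- by rewrite IH.
- by congr (_ :: _); rewrite -[LHS]/((u (omega 0%N) * (u (omega 0%N))^-1) y) mulgV.
- by rewrite IH.
- by congr (_ :: _); rewrite -[LHS]/(((u (omega 0%N))^-1 * u (omega 0%N)) y) mulVg.
Qed.

Lemma rec_rcons u omega w t : exists t',
  rec_fun u omega (rcons w t) = rcons (rec_fun u omega w) t'.
Proof.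
elim: w omega => [|[] y IH] omega /=.
- by exists t; case: t; rewrite ?tact_nil.
- by have [t' ->] := IH (wshift omega); exists t'.
- by have [t' ->] := tact_rcons (u (omega 0%N)) y t; exists t'.
Qed.

Definition rec_aut (u : 'I_3 -> taut) (omega : nat -> 'I_3) : taut :=
  @TAut (rec_fun u omega) (rec_bij u omega) erefl (rec_rcons u omega).

Lemma rec_autE u omega :
  rec_aut u omega = node (u (omega 0%N)) (rec_aut u (wshift omega)) 1.
Proof. by apply: taut_eq => -[|t y] //=; rewrite perm1. Qed.

Definition aut_a : taut := node 1 1 (tperm false true).

Definition ub (i : 'I_3) : taut := if val i == 2%N then 1 else aut_a.
Definition uc (i : 'I_3) : taut := if val i == 1%N then 1 else aut_a.
Definition ud (i : 'I_3) : taut := if val i == 0%N then 1 else aut_a.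

Definition aut_b : (nat -> 'I_3) -> taut := rec_aut ub.
Definition aut_c : (nat -> 'I_3) -> taut := rec_aut uc.
Definition aut_d : (nat -> 'I_3) -> taut := rec_aut ud.

Definition grig (omega : nat -> 'I_3) : groupType :=
  gen_type [set aut_a; aut_b omega; aut_c omega; aut_d omega].

Definition ray_act (x : nat -> bool) (g : taut) : nat -> bool :=
  fun n => nth false (g (mkseq x n.+1)) n.

Lemma mkseq_ray_act x (g : taut) n : mkseq (ray_act x g) n = g (mkseq x n).
Proof.
elim: n => [|n IH]; first by rewrite /mkseq /= tact_nil.
rewrite mkseqS IH /ray_act mkseqS.
have [t ->] := tact_rcons g (mkseq x n) (x n).
by rewrite nth_rcons size_tact size_mkseq ltnn eqxx.
Qed.

Lemma ray_act1 x : ray_act x 1 = x.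
Proof. by apply/funext => n; rewrite /ray_act nth_mkseq. Qed.

Lemma ray_actM x g h : ray_act x (g * h) = ray_act (ray_act x g) h.
Proof.
by apply/funext => n; rewrite [RHS]/ray_act mkseq_ray_act.
Qed.

Definition rho : nat -> bool := fun=> true.

Definition orbit_rho (omega : nat -> 'I_3) : set (nat -> bool) :=
  [set ray_act rho (val g) | g in [set: grig omega]].

Lemma orbit_act omega x (g : grig omega) :
  orbit_rho omega x -> orbit_rho omega (ray_act x (val g)).
Proof.
by move=> [h _ <-]; exists (h * g) => //; rewrite -ray_actM -valM.
Qed.

Definition orbit_ract (omega : nat -> 'I_3)
    (x : {x | orbit_rho omega x}) (g : grig omega) : {x | orbit_rho omega x} :=
  exist _ (ray_act (sval x) (val g)) (orbit_act g (svalP x)).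

Lemma orbit_ract1 omega x : @orbit_ract omega x 1 = x.
Proof. by case: x => x Xx; apply: eq_exist; rewrite val1 ray_act1. Qed.

Lemma orbit_ractM omega x g h :
  @orbit_ract omega x (g * h) = orbit_ract (orbit_ract x g) h.
Proof. by case: x => x Xx; apply: eq_exist; rewrite valM ray_actM. Qed.

Definition orbit_right_action (omega : nat -> 'I_3) : right_action (grig omega) :=
  RightAction (@orbit_ract1 omega) (@orbit_ractM omega).

Definition Gamma (F : finGroupType) (omega : nat -> 'I_3) : groupType :=
  wreath F (orbit_right_action omega).

(* Main.v *)
(* The sequence omega is a concatenation of long runs of 012012... and of 000...,
   the first ones occupying a proportion theta of the levels. Passing to the sections
   at the next level contracts total word length by eta in the first case, as in the
   estimate of Bartholdi, and does not increase it in the second one. A word of length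
   (2/eta)^(theta n) 2^((1 - theta) n) thus has 2^n sections of level n with total
   length O(2^n), which leaves at most exp(O(2^n)) elements of Gamma.

   The lower bound already holds for G_omega, hence for Gamma. The parity of the
   letters c, d read at rho along a word is an invariant of the automorphism (a germ
   modulo b). Consider e_1 s_1 e_2 s_2 ... e_m s_m with m = 2^n, each e_i being 1 or c,
   and each s_i a random product of short elements that move every vertex of level k to
   nearly 2^k equiprobable places when 2^k divides i. The trajectory of rho starting
   at the i-th place then rarely comes back to rho, so that the automorphism determines
   most of the e_i, and there are exp(c 2^n) such automorphisms. The elements used in
   s_i are iterates of the substitution zeta, which inverts the contraction above: both
   sections of zeta(w) are w, and its length is 2/eta or 2 times larger. *)

Require Import Defs.
From mathcomp Require Import all_boot all_order all_algebra all_fingroup.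
From Stdlib Require PeanoNat.
From mathcomp Require Import zify ring lra finmap.
From mathcomp Require Import all_classical all_reals all_analysis.
Import Order.TTheory GRing.Theory Num.Theory.
Import numFieldNormedType.Exports.
Set Implicit Arguments.
Unset Strict Implicit.
Unset Printing Implicit Defensive.
Local Open Scope nat_scope.

(** * Words and germs *)

(* The pair [(p, q)] stands for the element x of {1, b, c, d} such that
   u^x(0) = a iff p and u^x(1) = a iff q; then u^x(2) = a iff p (+) q. *)
Notation klein := (bool * bool)%type.
Implicit Types (x y : klein) (om : nat -> 'I_3) (v : seq bool).

(** As [F] may be trivial, the lower bound cannot count lamp configurations on [X]: the e_i must be
    recovered from an automorphism alone. They are read from left to right. The germ of the word
    gives the first e_i once the germ of what follows, its defect, is known; then the letters
    already read are cancelled. Rare defects are harmless: there are at most 2^(5*2^k) lists of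
    2^(k+3) defects with at most 2^k ones, against 2^(8*2^k) choices of the e_i. Jumps made with b
    have no germ, but are available only at levels whose letter is not 2; they open each spread and
    scatter the trajectory before the jumps that may have a germ. The germ is an invariant of the
    automorphism because it is visible at a level of letter 2 deeper than the word is long. The
    sequence is built in blocks of length of order sqrt n, so that up to level n both the number of
    changes of regime and the error on the density are O(sqrt n). This alters lengths by factors
    exp(O(sqrt n)), which the exponent does not see. *)

Definition kmul x y : klein := (x.1 (+) y.1, x.2 (+) y.2).

Definition kact (i : 'I_3) x : bool :=
  match val i with 0 => x.1 | 1 => x.2 | _ => x.1 (+) x.2 end.

Definition kb : klein := (true, true).
Definition kc : klein := (true, false).

Lemma kact_add i x y : kact i (kmul x y) = kact i x (+) kact i y.
Proof. by case: i x y => -[|[|[]]] // ? [[] []] [[] []]. Qed.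

Definition flip v := if v is t :: y then ~~ t :: y else [::].

Fixpoint vact x om v : seq bool :=
  if v is t :: y then
    t :: (if t then vact x (wshift om) y else if kact (om 0) x then flip y else y)
  else [::].

(* A letter is either [None], for a, or an element of {1, b, c, d}. *)
Definition lact om (l : option klein) v := if l is Some x then vact x om v else flip v.
Definition wact om (w : seq (option klein)) v := foldl (fun v l => lact om l v) v w.

Lemma wact_cat om w1 w2 v : wact om (w1 ++ w2) v = wact om w2 (wact om w1 v).
Proof. exact: foldl_cat. Qed.

Lemma flipK : involutive flip.
Proof. by case=> //= t y; rewrite negbK. Qed.

Lemma vactK x om : involutive (vact x om).
Proof.
move=> v; elim: v om => //= -[] y IH om /=; first by rewrite IH.
by case: (kact _ _) => //; rewrite flipK.
Qed.

Lemma lactK om l : involutive (lact om l).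
Proof. by case: l => [x|]; [exact: vactK | exact: flipK]. Qed.

Lemma size_flip v : size (flip v) = size v.
Proof. by case: v. Qed.

Lemma size_vact x om v : size (vact x om v) = size v.
Proof.
elim: v om => //= -[] y IH om /=; first by rewrite IH.
by case: (kact _ _); rewrite ?size_flip.
Qed.

Lemma size_wact om w v : size (wact om w v) = size v.
Proof.
elim: w v => //= l w IH v; rewrite IH.
by case: l => [x|]; [exact: size_vact | exact: size_flip].
Qed.

Lemma wact_inj om w : injective (wact om w).
Proof.
by elim: w => //= l w IH v v' /IH /(inv_inj (lactK om l)).
Qed.

Lemma vact_nseq x om n : vact x om (nseq n true) = nseq n true.
Proof. by elim: n om => //= n IH om; rewrite IH. Qed.

Definition base v := nseq (size v) true.

Definition chi x := kact ord_max x.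

(* The class modulo b of the germ at rho, as seen from level [size v]. *)
Fixpoint germ om (w : seq (option klein)) v : bool :=
  if w is l :: w' then
    (if l is Some x then chi x && (v == base v) else false)
      (+) germ om w' (lact om l v)
  else false.

Lemma germ_cat om w1 w2 v :
  germ om (w1 ++ w2) v = germ om w1 v (+) germ om w2 (wact om w1 v).
Proof. by elim: w1 v => //= l w IH v; rewrite IH addbA. Qed.

(** * The substitution and the jumps *)

Definition pairs (w : seq klein) : seq (option klein) :=
  flatten [seq [:: None; Some x] | x <- w].

Lemma pairs_cat w1 w2 : pairs (w1 ++ w2) = pairs w1 ++ pairs w2.
Proof. by rewrite /pairs map_cat flatten_cat. Qed.

Lemma size_pairs w : size (pairs w) = (size w).*2.
Proof. by elim: w => //= x w IH; rewrite -[RHS]/(((size w).*2).+2) -IH. Qed.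

Definition partner (i : 'I_3) : klein := if val i == 1 then (false, true) else kc.

(* The Bartholdi-Erschler substitution. If [x] acts at level 0 then ax becomes
   axax; otherwise it becomes ay ax az with x = yz, such as ad -> ac ad ab for the
   letter 0. *)
Definition zeta1 i x : seq klein :=
  if kact i x then [:: x; x] else [:: partner i; x; kmul x (partner i)].
Definition zeta i (w : seq klein) := flatten [seq zeta1 i x | x <- w].

(** The letters counted are those that [zeta1] sends to three pairs, hence to an odd number of a's:
    the parity tells whether [zeta i w] exchanges the two subtrees. *)
Definition nonmoving i (w : seq klein) : bool := odd (count (fun x => ~~ kact i x) w).

Definition align (s : bool) v := if s then v else flip v.
Lemma alignK s : involutive (align s).
Proof. by case: s => //; exact: flipK. Qed.

Lemma kact_partner i : kact i (partner i).
Proof. by case: i => -[|[|[]]]. Qed.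

Lemma vact_partner i om v x :
  vact (kmul x (partner i)) om (vact (partner i) om v) = vact x om v.
Proof.
elim: v om => //= -[] y IH om /=; first by rewrite IH.
by rewrite kact_add; case: (kact _ x); case: (kact _ _); rewrite ?flipK.
Qed.

Lemma vact_base x om v : (vact x om v == base v) = (v == base v).
Proof.
apply/eqP/eqP => [e|->]; last by rewrite /base size_nseq vact_nseq.
by rewrite -{1}(vactK x om v) e vact_nseq.
Qed.

(** When x is trivial at level 0, the word is a y a x a z with x = yz. From 1, both y and z are met
    at 0, where they act as a, and the section is axa. From 0, they are met at 1 and compose to x,
    while x is met at 0 and disappears. [align] absorbs the conjugation by a. *)
Lemma act_zeta1 om x s v :
  let s' := s (+) ~~ kact (om 0) x in
  wact om (pairs (zeta1 (om 0) x)) (s :: v) =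
    s' :: align s' (wact (wshift om) [:: None; Some x] (align s v)) /\
  germ om (pairs (zeta1 (om 0) x)) (s :: v) =
    germ (wshift om) [:: None; Some x] (align s v).
Proof.
rewrite /zeta1; case Ex: (kact (om 0) x); case: s => /=.
- rewrite Ex /= /base /= !eqseq_cons /= size_flip; split=> //.
  by rewrite !andbF.
- by rewrite Ex flipK /base /= !eqseq_cons /= !andbF !addbF.
- rewrite kact_add kact_partner Ex /= /base /= !eqseq_cons /= !andbF ?size_flip.
  by rewrite ?addbF.
- rewrite Ex flipK vact_partner /base /= !eqseq_cons /= !andbF /=.
  rewrite size_vact -/(base v) vact_base; split=> //.
  rewrite !addbF -andb_addl; congr andb.
  by rewrite /chi kact_add addbC -addbA addbb addbF.
Qed.

(* Up to conjugation by a, both sections of [zeta w] are [w]. *)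
Lemma act_zeta om w s v :
  let s' := s (+) nonmoving (om 0) w in
  wact om (pairs (zeta (om 0) w)) (s :: v) =
    s' :: align s' (wact (wshift om) (pairs w) (align s v)) /\
  germ om (pairs (zeta (om 0) w)) (s :: v) =
    germ (wshift om) (pairs w) (align s v).
Proof.
elim: w s v => [|x w IH] s v; first by rewrite /= /nonmoving /= addbF alignK.
have [ax gx] := act_zeta1 om x s v.
rewrite (_ : zeta _ _ = zeta1 (om 0) x ++ zeta (om 0) w) //.
rewrite (_ : pairs (x :: w) = [:: None; Some x] ++ pairs w) // pairs_cat !wact_cat !germ_cat gx ax.
have [-> ->] := IH (s (+) ~~ kact (om 0) x)
  (align (s (+) ~~ kact (om 0) x) (wact (wshift om) [:: None; Some x] (align s v))).
rewrite alignK; set p := nonmoving _ (_ :: _).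
suff -> : p = ~~ kact (om 0) x (+) nonmoving (om 0) w by rewrite !addbA.
by rewrite /p /nonmoving /= oddD oddb.
Qed.

Fixpoint zeta_iter om j (w : seq klein) : seq klein :=
  if j is j'.+1 then zeta (om 0) (zeta_iter (wshift om) j' w) else w.

Lemma nonmovingE i w :
  nonmoving i w = odd (size w) (+) kact i (foldr kmul (false, false) w).
Proof.
elim: w => [|x w IH] /=; first by case: i => -[|[|[]]].
rewrite kact_add {1}/nonmoving /= oddD oddb -/(nonmoving i w) IH.
by case: (kact i x); case: (odd _); case: (kact i _).
Qed.

Lemma kmul_zeta i w : foldr kmul (false, false) (zeta i w) = (false, false).
Proof.
elim: w => //= x w IH; rewrite /zeta /= foldr_cat -/(zeta i w) IH {IH} /zeta1.
have -> : foldr kmul (false, false) (if kact i x then [:: x; x] else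
    [:: partner i; x; kmul x (partner i)]) = (false, false); last by [].
by case: (kact i x); case: (partner i) => [[] []]; case: x => [[] []].
Qed.

Lemma size_zeta_odd i w : odd (size (zeta i w)) = nonmoving i w.
Proof.
elim: w => //= x w IH; rewrite /zeta /= size_cat oddD -/(zeta i w) IH.
rewrite /nonmoving /= oddD oddb; congr addb.
by rewrite /zeta1; case: (kact i x).
Qed.

(** A condition free of the letter [i], stable under [zeta], that makes [nonmoving i] vanish for all
    [i]. The squares xx satisfy it, so their iterates never exchange the subtrees. *)
Definition even_word (w : seq klein) :=
  ~~ odd (size w) && (foldr kmul (false, false) w == (false, false)).

Lemma even_wordP w i : even_word w -> nonmoving i w = false.
Proof.
case/andP=> /negbTE e /eqP k; rewrite nonmovingE e k.
by case: i => -[|[|[]]].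
Qed.

Lemma even_zeta_iter om j w : even_word w -> even_word (zeta_iter om j w).
Proof.
elim: j om => //= j IH om ew; rewrite /even_word size_zeta_odd kmul_zeta eqxx.
by rewrite even_wordP // IH.
Qed.

(* The jump below must flip a letter at the level where [i] is read; b does it
   except for [i = 2], and c does it then, at the price of a nontrivial germ. *)
Definition jump_letter (i : 'I_3) : klein := if i == ord_max then kc else kb.

Lemma kact_jump_letter i : kact i (jump_letter i).
Proof. by case: i => -[|[|[]]]. Qed.

Definition jump om j :=
  pairs (zeta_iter om j [:: jump_letter (om j); jump_letter (om j)]).

Lemma zeta_iterE om j s v x :
  wact om (pairs (zeta_iter om j.+1 [:: x; x])) (s :: v) =
    s :: align s (wact (wshift om) (pairs (zeta_iter (wshift om) j [:: x; x]))
      (align s v)) /\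
  germ om (pairs (zeta_iter om j.+1 [:: x; x])) (s :: v) =
    germ (wshift om) (pairs (zeta_iter (wshift om) j [:: x; x])) (align s v).
Proof.
have [/= -> ->] := act_zeta om (zeta_iter (wshift om) j [:: x; x]) s v.
rewrite even_wordP ?addbF // even_zeta_iter //.
by rewrite /even_word /=; case: x => [[] []].
Qed.

Lemma germ_jump_kb om j v : j <= size v -> om j != ord_max ->
  germ om (jump om j) v = false.
Proof.
rewrite /jump => + ne; rewrite /jump_letter (negbTE ne).
elim: j om v {ne} => [|j IH] om [|s v] //= jv.
have [_ ->] := zeta_iterE om j s v kb.
by apply: IH; case: s => //; rewrite size_flip.
Qed.

(** The innermost word is axax; when its x meets 1...1, only the first two letters can have been
    altered, so the others were already 1. *)
Lemma germ_jump om j v : j.+1 < size v -> germ om (jump om j) v ->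
  all id (drop j.+2 v).
Proof.
rewrite /jump; move: (jump_letter _) => x.
elim: j om v => [|j IH] om [|s [|t v]] // jv.
  have ones w : (w == base w) = all id w.
    by elim: w => //= -[] w <-; rewrite /base /= eqseq_cons.
  rewrite /= !ones {jv}; case: s => /=; rewrite ?andbF ?addbF //= drop0.
    by case: ifP => _ /and3P[].
  by case/and3P.
have [_ ->] := zeta_iterE om j s (t :: v) x.
by case: s jv => jv /IH h; apply: h.
Qed.

(* The letters after [j.+1] may change too. *)
Lemma nth_jump om j v i : j.+1 < size v -> i <= j.+1 ->
  nth false (wact om (jump om j) v) i = (i == j.+1) (+) nth false v i.
Proof.
rewrite /jump; have := kact_jump_letter (om j); move: (jump_letter _) => x.
elim: j om v i => [|j IH] om [|s v] //= i ax; rewrite ltnS => jv.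
  case: v jv => //= t v _; case: i => [|[|//]] _; case: s => //=;
    by rewrite ax //; case: t.
have [-> _] := zeta_iterE om j s v x.
case: i => //= i; rewrite ltnS eqSS => ij.
case: s => /=; first exact: IH.
have nf w : nth false (flip w) i = (i == 0) && (w != [::]) (+) nth false w i.
  by case: w i {ij} => [|? ?] [|i] //=; rewrite ?addbF // nth_nil.
rewrite nf IH ?size_flip // nf.
have ne w : 0 < size w -> (w != [::]) by case: w.
rewrite !ne ?size_wact ?size_flip ?(leq_ltn_trans _ jv) // !andbT.
by rewrite addbCA addKb.
Qed.

Fixpoint jumps om (js : seq nat) (u : seq bool) : seq (option klein) :=
  if js is j :: js' then
    (if head false u then jump om j else [::]) ++ jumps om js' (behead u)
  else [::].

Lemma nth_jumps om js u v i :
  all (fun j => (i <= j) && (j.+1 < size v)) js ->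
  nth false (wact om (jumps om js u) v) i = nth false v i.
Proof.
elim: js u v => //= j js IH u v /andP[/andP[ij jv] jsv].
rewrite wact_cat IH ?size_wact //; case: ifP => // _.
by rewrite nth_jump ?(leqW ij) // ltn_eqF.
Qed.

(** A jump of level [j] toggles letter [j.+1], and the later ones, of higher level, leave it alone:
    the bits are read off in increasing order of level. *)
Lemma jumps_inj om js u u' v : sorted ltn js ->
  all (fun j => j.+1 < size v) js -> size u = size js -> size u' = size js ->
  wact om (jumps om js u) v = wact om (jumps om js u') v -> u = u'.
Proof.
elim: js u u' v => [|j js IH] [|t u] [|t' u'] v //= js_s /andP[jv jsv] [su] [su'].
rewrite !wact_cat => e.
have jsl : all (fun i => j.+1 <= i) js by move: js_s; rewrite (path_sortedE ltn_trans) => /andP[].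
have E : t = t'.
  have := congr1 (fun z => nth false z j.+1) e.
  rewrite !nth_jumps ?size_wact; first last.
  - by apply/allP => i ij; rewrite (allP jsl) //= (allP jsv).
  - by apply/allP => i ij; rewrite (allP jsl) //= (allP jsv).
  have K b : nth false (wact om (if b then jump om j else [::]) v) j.+1 =
             b (+) nth false v j.+1.
    by case: b => //; rewrite nth_jump ?eqxx.
  by rewrite !K => /addIb.
subst t'; congr cons; apply: IH e => //; first exact: path_sorted js_s.
by rewrite size_wact.
Qed.

Lemma germ_jumps_kb om js u v :
  all (fun j => (j <= size v) && (om j != ord_max)) js ->
  germ om (jumps om js u) v = false.
Proof.
elim: js u v => //= j js IH u v /andP[/andP[jv ne] jsv].
rewrite germ_cat IH ?size_wact // addbF; case: ifP => // _.
exact: germ_jump_kb.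
Qed.

(** * Counting the vertices where jumps have a germ *)

Lemma take_vact x om v m : take m (vact x om v) = vact x om (take m v).
Proof.
elim: v om m => [|t v IH] om [|m] //=; congr cons; case: t => //.
by case: ifP => //; case: v m {IH} => [|t v] [|m].
Qed.

Lemma take_wact om w v m : take m (wact om w v) = wact om w (take m v).
Proof.
elim: w v => //= l w IH v; rewrite IH; congr foldl.
by case: l => [x|] /=; [exact: take_vact | by case: v m {IH} => [|t v] [|m]].
Qed.

Lemma all_id_nseq v : all id v -> v = nseq (size v) true.
Proof. by elim: v => //= -[] v IH //= /IH {1}->. Qed.

Lemma eq_take_drop m v v' : size v = size v' ->
  all id (drop m v) -> all id (drop m v') -> take m v = take m v' -> v = v'.
Proof.
move=> s /all_id_nseq e /all_id_nseq e' t.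
by rewrite -(cat_take_drop m v) -(cat_take_drop m v') t e e' !size_drop s.
Qed.

Lemma card_all_drop (I : finType) (f : I -> seq bool) M m : injective f ->
  (forall i, size (f i) = M) -> m <= M ->
  #|[pred i | all id (drop m (f i))]| <= 2 ^ m.
Proof.
move=> f_inj fM mM; rewrite -[X in X ^ m]card_bool -card_tuple.
have st i : size (take m (f i)) == m by rewrite size_takel ?fM.
apply: (@leq_card_in _ _ (fun i => Tuple (st i))) => i k.
rewrite !inE => hi hk /(congr1 val) /= e.
by apply: f_inj; apply: eq_take_drop hi hk e; rewrite !fM.
Qed.

Lemma card_all_drop1 (I : finType) (f : I -> seq bool) M m n : injective f ->
  (forall i, size (f i) = M) -> m <= n ->
  (forall i k, take n (f i) = take n (f k)) ->
  #|[pred i | all id (drop m (f i))]| <= 1.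
Proof.
move=> f_inj fM mn ft; apply/card_le1P => i; rewrite !inE => hi k; rewrite !inE.
apply/idP/eqP => [hk|->//].
apply: f_inj; apply: eq_take_drop hk hi _; rewrite ?fM //.
have := ft k i => /(congr1 (take m)).
by rewrite !take_takel.
Qed.

Lemma leq_card_addb (I : finType) (P Q : pred I) :
  #|[pred i | P i (+) Q i]| <= #|[pred i | P i]| + #|[pred i | Q i]|.
Proof.
rewrite -cardUI; apply: leq_trans (leq_addr _ _).
by apply: subset_leq_card; apply/fintype.subsetP => i; rewrite !inE; case: (P i); case: (Q i).
Qed.

(** [C] is a class of families of vertices stable under words: the injective families, or those that
    moreover share a prefix. *)
Lemma card_germ_jumps om js u (I : finType) (C : (I -> seq bool) -> Prop) (c : nat -> nat) :
  (forall f w, C f -> C (fun i => wact om w (f i))) ->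
  (forall f j, C f -> j \in js -> #|[pred i | germ om (jump om j) (f i)]| <= c j) ->
  forall f, C f -> #|[pred i | germ om (jumps om js u) (f i)]| <= \sum_(j <- js) c j.
Proof.
move=> Cw Cj; elim: js u Cj => [|j js IH] u Cj f Cf /=.
  by rewrite big_nil card0.
set e := (if head false u then _ else _).
rewrite big_cons (eq_card (B := [pred i | germ om e (f i) (+)
  germ om (jumps om js (behead u)) (wact om e (f i))])); last first.
  by move=> i; rewrite !inE germ_cat.
apply: leq_trans (leq_card_addb _ _) _; apply: leq_add.
  rewrite {}/e; case: (head false u); first by apply: Cj; rewrite ?mem_head.
  by rewrite eq_card0.
apply: IH; last exact: Cw.
by move=> f' k Cf' kjs; apply: Cj => //; rewrite inE kjs orbT.
Qed.

(** * Reading the germ in the action *)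

Lemma all_id_dropS N v : all id (drop N v) -> all id (drop N.+1 v).
Proof.
by rewrite -add1n -drop_drop; case: (drop N v) => //= ? ? /andP[_]; rewrite drop0.
Qed.

Lemma all_id_drop_flip N v : all id (drop N v) -> all id (drop N.+1 (flip v)).
Proof. by move/all_id_dropS; case: v. Qed.

Lemma vact_cat x om v t : ~~ all id v -> last true v ->
  vact x om (v ++ t) = vact x om v ++ t.
Proof.
elim: v om => //= -[] v IH om /=; first by move=> nv l; rewrite IH.
by move=> _ l; case: (kact _ _) => //; case: v l {IH}.
Qed.

Lemma vact_nseq_cat x om m t :
  vact x om (nseq m true ++ t) = nseq m true ++ vact x (iter m wshift om) t.
Proof. by elim: m om => //= m IH om; rewrite IH -iterSr. Qed.

Lemma all_id_drop_vact x om N v :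
  all id (drop N v) -> all id (drop N.+1 (vact x om v)).
Proof.
elim: v om N => [|t v IH] om [|N] // h.
  move: (h); rewrite drop0 => /all_id_nseq ->; rewrite vact_nseq.
  by apply/all_id_dropS; rewrite drop0 all_nseq orbT.
case: t h => /= h; first exact: IH.
by case: (kact _ _); [exact: all_id_drop_flip | exact: all_id_dropS].
Qed.

(* The letter following 1...10 records the germ when [om M] is 2, since then c
   and d act there while b does not. *)
Lemma probe_step om M w v z N : om M = ord_max -> size v = M ->
  all id (drop N v) -> N + size w < M ->
  wact om w (v ++ [:: false; z]) =
  wact om w v ++ [:: false; z (+) germ om w v].
Proof.
move=> omM; elim: w v z N => [|l w IH] v z N vM o /= sw; first by rewrite addbF.
have NM : N < M by apply: leq_ltn_trans sw; exact: leq_addr.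
have iterE m k : iter m wshift om k = om (m + k).
  by elim: m k => //= m IHm k; rewrite /wshift IHm addnS.
case: l => [x|] /=; last first.
  have -> : flip (v ++ [:: false; z]) = flip v ++ [:: false; z].
    by case: v vM {o} => //= e; rewrite -e in NM.
  by apply: (IH _ _ N.+1); rewrite ?size_flip ?addSnnS ?all_id_drop_flip.
have [vb|vb] := boolP (all id v).
  rewrite (all_id_nseq vb) vM vact_nseq_cat vact_nseq /= iterE addn0 omM.
  have -> : nseq M true == base (nseq M true) by rewrite /base size_nseq eqxx.
  rewrite andbT -/(chi x) addbA.
  have -> : (if chi x then flip [:: z] else [:: z]) = [:: z (+) chi x].
    by case: (chi x); case: z.
  rewrite (IH _ _ N.+1) ?size_nseq ?addSnnS //.
  by apply/all_id_dropS/allP => b /mem_drop /nseqP[->].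
(* The letters of [v] past [N] are still 1, so its first 0 is not its last letter, and the letter
   that may change lies inside [v]. *)
have levels : last true v.
  rewrite -(cat_take_drop N v) last_cat.
  have : 0 < size (drop N v) by rewrite size_drop vM subn_gt0.
  case/lastP: (drop N v) o => // s b; rewrite all_rcons last_rcons.
  by case/andP.
rewrite vact_cat //.
have -> : (v == base v) = false.
  by apply/negP => /eqP e; case/negP: vb; rewrite e /base all_nseq orbT.
rewrite andbF addFb; apply: (IH _ _ N.+1); rewrite ?size_vact ?addSnnS //.
exact: all_id_drop_vact.
Qed.

Lemma probe om M w : om M = ord_max -> size w < M ->
  wact om w (nseq M true ++ [:: false; false]) =
  wact om w (nseq M true) ++ [:: false; germ om w (nseq M true)].
Proof.
move=> omM wM; rewrite (@probe_step om M w _ false 0) ?size_nseq //.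
by rewrite drop0 all_nseq orbT.
Qed.

(** * Lower bound *)

Fixpoint lampT n : finType := if n is k.+1 then (lampT k * lampT k)%type else bool.

Fixpoint weight n : lampT n -> nat :=
  if n is k.+1 then fun e => weight e.1 + weight e.2 else fun e : bool => nat_of_bool e.

Section Counting.
Variables (om : nat -> 'I_3) (levels : nat -> seq nat) (M : nat).

(* The product [spread u] of jumps takes every vertex to 2 ^ #bits different
   ones. Jumps without germ at the levels [levels n], all above [n], come first, so that
   the subsequent jumps rarely meet the vertex 1...1. *)
Definition bitsT n : finType :=
  ((size (levels n)).-tuple bool * n.-tuple bool)%type.

Definition spread n (u : bitsT n) : seq (option klein) :=
  jumps om (levels n) u.1 ++ jumps om (iota 0 n) u.2.

Fixpoint jumpT n : finType :=
  if n is k.+1 then (jumpT k * bitsT k * jumpT k)%type else unit.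

(* 2 ^ n lamps c ^ e; the two halves of a dyadic block of 2 ^ k.+1 lamps are
   separated by a spread of scale [k]. *)
Fixpoint word n : jumpT n -> lampT n -> seq (option klein) :=
  match n with
  | 0 => fun _ e => if e : bool then [:: Some kc] else [::]
  | k.+1 => fun d e => word d.1.1 e.1 ++ spread d.1.2 ++ word d.2 e.2
  end.

Definition rho_prefix := nseq M true.

(* For each lamp, the germ at 1...1 of what follows it in the word followed by
   [r]. The germ of the remaining word is the lamp plus its defect. *)
Fixpoint defect n : jumpT n -> lampT n -> seq (option klein) -> lampT n :=
  match n with
  | 0 => fun _ _ r => germ om r rho_prefix
  | k.+1 => fun d e r =>
      (defect d.1.1 e.1 (spread d.1.2 ++ word d.2 e.2 ++ r), defect d.2 e.2 r)
  end.

(** At level [M], the inverted orbit of [rho]: its images under what follows each lamp in the word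
    and in [r]. *)
Fixpoint exits n : jumpT n -> lampT n -> seq (option klein) -> seq (seq bool) :=
  match n with
  | 0 => fun _ _ r => [:: wact om r rho_prefix]
  | k.+1 => fun d e r =>
      exits d.1.1 e.1 (spread d.1.2 ++ word d.2 e.2 ++ r) ++ exits d.2 e.2 r
  end.

Lemma size_exits n (d : jumpT n) e r : size (exits d e r) = 2 ^ n.
Proof.
elim: n d e r => //= n IH d e r.
by rewrite size_cat !IH expnS mul2n addnn.
Qed.

Lemma all_size_exits n (d : jumpT n) e r :
  all (fun z => size z == M) (exits d e r).
Proof.
elim: n d e r => [|n IH] d e r /=; first by rewrite size_wact size_nseq eqxx.
by rewrite all_cat !IH.
Qed.

(** Appending [r] toggles the defect of a lamp exactly when [r] has a germ at the corresponding
    point of [exits]. *)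
Lemma weight_defect n (d : jumpT n) e q r :
  weight (defect d e (q ++ r)) <=
  weight (defect d e q) + count (germ om r) (exits d e q).
Proof.
elim: n d e q r => [|n IH] d e q r /=.
  rewrite germ_cat addn0.
  by case: (germ om q _); case: (germ om r _).
rewrite count_cat addnACA leq_add //.
by rewrite (_ : spread _ ++ _ = (spread d.1.2 ++ word d.2 e.2 ++ q) ++ r) // -!catA.
Qed.

Hypothesis omM : om M = ord_max.

Lemma germ_eq w w' : size w < M -> size w' < M ->
  wact om w =1 wact om w' -> germ om w rho_prefix = germ om w' rho_prefix.
Proof.
move=> wM wM' /(_ (rho_prefix ++ [:: false; false])); rewrite !probe //.
by move/(congr1 (last false)); rewrite !last_cat.
Qed.

Lemma wact_cancel w r r' :
  wact om (w ++ r) =1 wact om (w ++ r') -> wact om r =1 wact om r'.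
Proof.
move=> e v; have [g _ gK] : bijective (wact om w).
  elim: w {e} => /= [|l w [g gK Kg]]; first by exists id.
  exists (fun v => lact om l (g v)) => z.
    by rewrite -[wact _ _ z]/(wact om w (lact om l z)) gK lactK.
  by rewrite -[LHS]/(wact om w (lact om l (lact om l (g z)))) lactK Kg.
by have := e (g v); rewrite !wact_cat gK.
Qed.

(* The first lamp is recovered from the germ of the automorphism and from its
   defect; it can then be cancelled on the left. *)
Lemma defect_inj n (d : jumpT n) e e' r r' :
  size (word d e ++ r) < M -> size (word d e' ++ r') < M ->
  wact om (word d e ++ r) =1 wact om (word d e' ++ r') ->
  defect d e r = defect d e' r' -> e = e' /\ wact om r =1 wact om r'.
Proof.
elim: n d e e' r r' => [|n IH] /=.
  move=> _ e e' r r' s s' E D.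
  have g := germ_eq s s' E.
  have lampE b q : germ om ((if b : bool then [:: Some kc] else [::]) ++ q) rho_prefix =
      b (+) germ om q rho_prefix.
    by case: b => //=; rewrite vact_nseq {1 2}/rho_prefix /base size_nseq eqxx.
  have ee : e = e' by move: g; rewrite !lampE D => /addIb.
  by subst e'; split=> //; exact: wact_cancel E.
move=> [[d1 u] d2] [e1 e2] [e1' e2'] r r' /=; rewrite -!catA => s s' E [D1 D2].
have [ee E2] := IH _ _ _ _ _ s s' E D1; subst e1'.
have E3 := wact_cancel (wact_cancel E2).
by have [||-> //] := IH _ _ _ _ _ _ _ E3 D2;
  [move: s | move: s']; rewrite !size_cat; apply: leq_ltn_trans;
  rewrite !addnA leq_add2r leq_addl.
Qed.

Variable N : nat.
Hypothesis levels_sorted : forall n, sorted ltn (levels n).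
Hypothesis levelsP : forall n j, n < N -> j \in levels n ->
  [&& n <= j, j.+1 < M & om j != ord_max].
Hypothesis NM : N < M.

Definition level_inj (I : finType) (f : I -> seq bool) :=
  injective f /\ forall i, size (f i) = M.

Lemma level_inj_wact (I : finType) (f : I -> seq bool) w :
  level_inj f -> level_inj (fun i => wact om w (f i)).
Proof.
case=> f_inj fM; split=> [|i]; last by rewrite size_wact.
by move=> i k /wact_inj /f_inj.
Qed.

Lemma germ_jumps_levels n u v : n < N -> size v = M -> germ om (jumps om (levels n) u) v = false.
Proof.
move=> nN vM; apply/germ_jumps_kb/allP => j /(levelsP nN) /and3P[_ jM ->].
by rewrite vM andbT ltnW // ltnW.
Qed.

(** The jumps of [levels n] have no germ. One of level [j] below [n] has a germ only at vertices
    that are 1 from letter [j.+2] on, at most 2^(j+2) in number. *)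
Lemma card_germ_spread (I : finType) (f : I -> seq bool) n (u : bitsT n) :
  n < N -> level_inj f ->
  #|[pred i | germ om (spread u) (f i)]| <= 2 ^ n.+2.
Proof.
move=> nN fP.
rewrite (eq_card (B := [pred i | germ om (jumps om (iota 0 n) u.2)
    (wact om (jumps om (levels n) u.1) (f i))])); last first.
  by move=> i; rewrite !inE germ_cat germ_jumps_levels //; case: fP.
apply: (@leq_trans (\sum_(j <- iota 0 n) 2 ^ j.+2)).
  apply: (card_germ_jumps _ (@level_inj_wact I)); last exact: level_inj_wact.
  move=> g j [g_inj gM]; rewrite mem_iota add0n => /andP[_ jn].
  have jM : j.+1 < M by apply: leq_trans NM; rewrite ltnS (leq_trans jn) // ltnW.
  apply: leq_trans (card_all_drop g_inj gM jM).
  apply/subset_leq_card/fintype.subsetP => i; rewrite !inE.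
  by apply: germ_jump; rewrite gM.
elim: n {nN u} => [|n IH]; first by rewrite big_nil.
by rewrite -addn1 iotaD big_cat big_seq1 /= add0n addn1 [X in _ <= X]expnS mul2n -addnn leq_add2r.
Qed.

(** The bound solves a(0) = 1, a(n+1) = 2 a(n) + 2^(n+2): two halves and the spread between them. *)
Lemma card_germ_word n (d : jumpT n) e (I : finType) (f : I -> seq bool) :
  n <= N -> level_inj f ->
  #|[pred i | germ om (word d e) (f i)]| <= n.*2.+1 * 2 ^ n.
Proof.
elim: n d e I f => [|n IH] d e I f nN fP.
  rewrite mul1n; apply/card_le1P => i; rewrite !inE => gi k; rewrite !inE.
  apply/idP/eqP => [gk|->//]; case: fP gi gk => f_inj fM.
  case: e => //=; rewrite !addbF => /eqP ei /eqP ek.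
  by apply: f_inj; rewrite [LHS]ek [RHS]ei /base !fM.
rewrite (eq_card (B := [pred i | germ om (word d.1.1 e.1) (f i) (+)
    (germ om (spread d.1.2 ++ word d.2 e.2) (wact om (word d.1.1 e.1) (f i)))])); last first.
  by move=> i; rewrite !inE /= germ_cat.
apply: leq_trans (leq_card_addb _ _) _.
pose g i := wact om (word d.1.1 e.1) (f i).
have gP : level_inj g by exact: level_inj_wact.
rewrite [X in _ + X](eq_card (B := [pred i |
    germ om (spread d.1.2) (g i) (+)
    (germ om (word d.2 e.2) (wact om (spread d.1.2) (g i)))])); last first.
  by move=> i; rewrite !inE germ_cat.
have A1 := IH d.1.1 e.1 I f (ltnW nN) fP.
have A2 := card_germ_spread d.1.2 nN gP.
have A3 := IH d.2 e.2 I _ (ltnW nN) (level_inj_wact (spread d.1.2) gP).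
apply: leq_trans (leq_add A1 (leq_trans (leq_card_addb _ _) (leq_add A2 A3))) _.
by rewrite !expnS -!muln2; lia.
Qed.

Lemma take_jumps_levels n u v : n < N -> size v = M ->
  take n.+1 (wact om (jumps om (levels n) u) v) = take n.+1 v.
Proof.
move=> nN vM.
have sz w : size w = M -> size (take n.+1 w) = n.+1.
  by move=> wM; rewrite size_takel // wM (leq_trans nN) // ltnW.
apply: (@eq_from_nth _ false) => [|i]; rewrite !sz ?size_wact // => iN.
rewrite !nth_take // nth_jumps //; apply/allP => j jl.
have /and3P[nj jM _] := levelsP nN jl.
by rewrite vM jM andbT (leq_trans _ nj) // -ltnS.
Qed.

(** The high jumps fix the first [n.+1] letters, where the low jumps then write their bits; the low
    jumps are thus known and can be cancelled. *)
Lemma spread_inj n (v : seq bool) : n < N -> size v = M ->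
  level_inj (fun u : bitsT n => wact om (spread u) v).
Proof.
move=> nN vM; split=> [|u]; last by rewrite size_wact.
move=> [uB uA] [uB' uA'] /=; rewrite /spread !wact_cat /= => e.
have lvM : all (fun j => j.+1 < size v) (levels n).
  by apply/allP => j /(levelsP nN) /and3P[_ jM _]; rewrite vM.
have tB := take_jumps_levels _ nN vM.
have eA : uA = uA'.
  have := congr1 (take n.+1) e; rewrite !(take_wact _ (jumps om (iota 0 n) _)) !tB.
  move/jumps_inj => h; apply/val_inj/h; rewrite ?size_tuple ?size_iota ?iota_ltn_sorted //.
  apply/allP => j; rewrite mem_iota add0n /= => jn.
  by rewrite size_takel ?ltnS // vM (leq_trans nN) // ltnW.
subst uA'; move/wact_inj: e => /jumps_inj h; congr pair.
by apply/val_inj/h; rewrite ?size_tuple.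
Qed.

(** Here the vertex is fixed and the bits vary. The low bits being given, the first [n.+1] letters
    do not depend on the high bits, so that each of the [n] low jumps meets a vertex with a germ for
    at most one choice of the high bits. *)
Lemma card_germ_spread1 n (v : seq bool) : n < N -> size v = M ->
  #|[pred u : bitsT n | germ om (spread u) v]| <= n * #|{: n.-tuple bool}|.
Proof.
move=> nN vM.
rewrite -sum1_card (eq_bigl (fun u : bitsT n => germ om (spread u) v)) //.
rewrite (eq_bigl (fun u : bitsT n => true && germ om (spread (u.1, u.2)) v)); last by case.
rewrite -(pair_big_dep xpredT (fun uB uA => germ om (spread (uB, uA)) v) (fun _ _ => 1)) /=.
rewrite (exchange_big_dep xpredT) //= mulnC -sum_nat_const; apply: leq_sum => uA _.
rewrite sum1_card.
pose C (f : (size (levels n)).-tuple bool -> seq bool) :=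
  level_inj f /\ forall i k, take n.+1 (f i) = take n.+1 (f k).
have Cw f w : C f -> C (fun i => wact om w (f i)).
  by case=> fP ft; split; [exact: level_inj_wact | move=> i k; rewrite !take_wact (ft i k)].
rewrite (eq_card (B := [pred i : (size (levels n)).-tuple bool |
    germ om (jumps om (iota 0 n) uA) (wact om (jumps om (levels n) i) v)])); last first.
  by move=> i; rewrite !inE unfold_in /= germ_cat germ_jumps_levels.
apply: (@leq_trans (\sum_(j <- iota 0 n) 1)); last by rewrite sum1_size size_iota.
apply: (card_germ_jumps _ Cw) => [f j [[f_inj fM] ft]|].
  rewrite mem_iota add0n => /andP[_ jn].
  apply: leq_trans (card_all_drop1 f_inj fM (_ : j.+2 <= n.+1) ft); last by rewrite ltnS.
  apply/subset_leq_card/fintype.subsetP => i; rewrite !inE.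
  by apply: germ_jump; rewrite fM (leq_trans _ NM) // ltnS (leq_trans jn) // ltnW.
split.
  split=> [i k e|i]; last by rewrite size_wact.
  have [h _] := spread_inj nN vM.
  suff [] : (i, uA) = (k, uA) by [].
  by apply: h; rewrite /= /spread !wact_cat e.
by move=> i k; rewrite !take_jumps_levels.
Qed.

(* Given the rest of the word, a lamp is read wrongly for few of the choices of [u]. *)
Lemma card_bad n (d : jumpT n) e (v : seq bool) : n < N -> size v = M ->
  #|[pred u : bitsT n | germ om (spread u ++ word d e) v]| <=
  (3 * n).+1 * 2 ^ n.
Proof.
move=> nN vM.
rewrite (eq_card (B := [pred u | germ om (spread u) v (+)
    germ om (word d e) (wact om (spread u) v)])); last first.
  by move=> u; rewrite !inE germ_cat.
apply: leq_trans (leq_card_addb _ _) _.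
have A1 := card_germ_spread1 nN vM.
rewrite card_tuple card_bool in A1.
have A2 := card_germ_word d e (ltnW nN) (spread_inj nN vM).
by apply: leq_trans (leq_add A1 A2) _; rewrite -muln2; lia.
Qed.

Lemma sum_fst (A B : finType) (f : A -> nat) :
  \sum_(p : A * B) f p.1 = #|B| * \sum_a f a.
Proof.
rewrite -(pair_bigA _ (fun a _ => f a)) /= big_distrr /=.
by apply: eq_bigr => a _; rewrite sum_nat_const.
Qed.

Lemma sum_snd (A B : finType) (f : B -> nat) :
  \sum_(p : A * B) f p.2 = #|A| * \sum_b f b.
Proof. by rewrite -(pair_bigA _ (fun _ b => f b)) /= sum_nat_const. Qed.

Lemma sum_bad n (d : jumpT n) e (s : seq (seq bool)) : n < N ->
  all (fun v => size v == M) s ->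
  \sum_(u : bitsT n) count (germ om (spread u ++ word d e)) s <=
  size s * ((3 * n).+1 * 2 ^ n).
Proof.
move=> nN; elim: s => [|v s IH] /=; first by rewrite big1_eq.
case/andP=> /eqP vM /IH {}IH; rewrite big_split mulSn leq_add //=.
apply: leq_trans (card_bad d e nN vM); rewrite -sum1_card [X in _ <= X]big_mkcond /=.
by apply: leq_sum => u _; rewrite inE; case: (germ _ _ _).
Qed.

Variable h : nat.
Hypothesis levels_size : forall n, n < N -> h <= size (levels n).

Lemma card_bitsT n : #|bitsT n| = 2 ^ size (levels n) * 2 ^ n.
Proof. by rewrite card_prod !card_tuple card_bool. Qed.

(** For the averages over [d] and [e] this is A(n+1) <= 2 A(n) + 2^n (3n+1) / 2^h: by [card_bad],
    each of the 2^n lamps of the first half is spoiled by what follows with probability at most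
    (3n+1) / 2^h. The closed form uses 4n^2 + 3n + 1 <= 4(n+1)^2. *)
Lemma sum_weight n : n <= N ->
  (\sum_(d : jumpT n) \sum_(e : lampT n) weight (defect d e [::])) * 2 ^ h <=
  2 * n ^ 2 * 2 ^ n * (#|jumpT n| * #|lampT n|).
Proof.
elim: n => [|n IH] nN; first by rewrite big1 // => d _; rewrite big1.
have {}IH := IH (ltnW nN).
set S := \sum_(d : jumpT n) _ in IH; set J := #|jumpT n| in IH *; set L := #|lampT n| in IH *.
have hB : 2 ^ h * ((3 * n).+1 * 2 ^ n) <= (3 * n).+1 * #|bitsT n|.
  by rewrite card_bitsT mulnCA leq_mul2l leq_mul2r leq_exp2l // levels_size // !orbT.
set B := #|bitsT n| in hB.
rewrite [X in _ <= _ * (X * _)](_ : _ = J * B * J); last by rewrite /= card_prod card_prod.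
rewrite [X in _ <= _ * (_ * X)](_ : _ = L * L); last by rewrite /= card_prod.
pose a (d : jumpT n) (e : lampT n) := weight (defect d e [::]).
pose c (d : jumpT n.+1) (e : lampT n.+1) :=
  count (germ om (spread d.1.2 ++ word d.2 e.2)) (exits d.1.1 e.1 [::]).
have S1 : \sum_(d : jumpT n.+1) \sum_(e : lampT n.+1) a d.1.1 e.1 = B * J * L * S.
  under eq_bigr do rewrite (sum_fst _ (a _.1.1)).
  rewrite -big_distrr /=.
  rewrite (sum_fst _ (fun p : jumpT n * bitsT n => \sum_e a p.1 e)).
  by rewrite (sum_fst _ (fun d => \sum_e a d e)) -/S -/J -/B -/L; lia.
have S2 : \sum_(d : jumpT n.+1) \sum_(e : lampT n.+1) a d.2 e.2 = B * J * L * S.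
  under eq_bigr do rewrite (sum_snd _ (a _.2)).
  rewrite -big_distrr /= (sum_snd _ (fun d => \sum_e a d e)) -/S.
  by rewrite card_prod -/J -/B -/L; lia.
pose K := (3 * n).+1 * 2 ^ n.
have S3 : \sum_(d : jumpT n.+1) \sum_(e : lampT n.+1) c d e <=
    J * J * (L * L) * (2 ^ n * K).
  (* The bits of the middle spread are summed innermost, since the exits of the first half do not
     involve them. *)
  have -> : \sum_(d : jumpT n.+1) \sum_(e : lampT n.+1) c d e =
    \sum_(d1 : jumpT n) \sum_(d2 : jumpT n) \sum_(e : lampT n.+1)
      \sum_(u : bitsT n) c (d1, u, d2) e.
    rewrite -(pair_bigA _ (fun p d2 => \sum_e c (p, d2) e)) /=.
    rewrite -(pair_bigA _ (fun d1 u => \sum_d2 \sum_e c (d1, u, d2) e)) /=.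
    by apply: eq_bigr => d1 _; rewrite exchange_big /=; apply: eq_bigr => d2 _;
      rewrite exchange_big.
  apply: (@leq_trans (\sum_(d1 : jumpT n) \sum_(d2 : jumpT n)
      \sum_(e : lampT n.+1) 2 ^ n * K)).
    apply: leq_sum => d1 _; apply: leq_sum => d2 _; apply: leq_sum => e _.
    have := sum_bad d2 e.2 nN (all_size_exits d1 e.1 [::]).
    by rewrite size_exits.
  by rewrite !sum_nat_const /= card_prod -/J -/L !mulnA.
have le_abc : \sum_(d : jumpT n.+1) \sum_(e : lampT n.+1) weight (defect d e [::]) <=
    B * J * L * S + B * J * L * S + J * J * (L * L) * (2 ^ n * K).
  rewrite -[X in X + _ + _]S1 -[X in _ + X + _]S2.
  apply: leq_trans (leq_add (leqnn _) S3).
  rewrite -!big_split /=; apply: leq_sum => d _; rewrite -!big_split /=.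
  apply: leq_sum => e _ /=.
  have := weight_defect d.1.1 e.1 [::] (spread d.1.2 ++ word d.2 e.2).
  by rewrite cats0 /= /a /c addnAC leq_add2r.
apply: leq_trans (leq_mul le_abc (leqnn _)) _.
have e1 : (B * J * L * S + B * J * L * S) * 2 ^ h <=
    2 * (B * J * L) * (2 * n ^ 2 * 2 ^ n * (J * L)).
  by rewrite addnn -mul2n -!mulnA !leq_mul2l; move: IH; rewrite !mulnA => ->; rewrite !orbT.
have e2 : J * J * (L * L) * (2 ^ n * K) * 2 ^ h <=
    J * J * (L * L) * 2 ^ n * ((3 * n).+1 * B).
  have -> : J * J * (L * L) * (2 ^ n * K) * 2 ^ h =
    J * J * (L * L) * 2 ^ n * (2 ^ h * K).
    by rewrite [2 ^ h * K]mulnC !mulnA.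
  by rewrite leq_mul2l hB orbT.
rewrite mulnDl; apply: leq_trans (leq_add e1 e2) _.
rewrite (expnS 2 n); set T := 2 ^ n.
have -> : 2 * (B * J * L) * (2 * n ^ 2 * T * (J * L)) +
  J * J * (L * L) * T * ((3 * n).+1 * B) =
  (J * B * J * (L * L) * T) * (4 * n ^ 2 + (3 * n).+1) by lia.
have -> : 2 * n.+1 ^ 2 * (2 * T) * (J * B * J * (L * L)) =
  (J * B * J * (L * L) * T) * (4 * n.+1 ^ 2) by lia.
by rewrite leq_mul2l; apply/orP; right; lia.
Qed.
End Counting.

Lemma weight_le n (e : lampT n) : weight e <= 2 ^ n.
Proof.
elim: n e => [[]|n IH] // [e1 e2].
by rewrite expnS mul2n -addnn leq_add.
Qed.

(* Generating function for a Chernoff bound. *)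
Lemma sum_exp_weight n :
  \sum_(e : lampT n) 3 ^ (2 ^ n - weight e) = 4 ^ (2 ^ n).
Proof.
elim: n => [|n IH]; first by rewrite big_bool.
rewrite [in RHS](expnS 2 n) [2 * _]mulnC expnM -mulnn -IH big_distrlr /=.
rewrite pair_bigA /=; apply: eq_bigr => -[e1 e2] _ /=.
by rewrite -expnD; congr expn; move: (weight_le e1) (weight_le e2); rewrite expnS; lia.
Qed.

Lemma card_lampT n : #|lampT n| = 2 ^ 2 ^ n.
Proof.
elim: n => [|n IH] /=; first by rewrite card_bool.
by rewrite card_prod IH -expnD addnn -mul2n -expnS.
Qed.

(** Each light element contributes at least 3^(7 * 2^k) to the sum 4^(8 * 2^k) of [sum_exp_weight],
    and 4^8 = 65536 <= 69984 = 32 * 3^7. *)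
Lemma card_light k :
  #|[pred e : lampT k.+3 | weight e <= 2 ^ k]| <= 32 ^ (2 ^ k).
Proof.
set C := #|_|; have E : 2 ^ k.+3 = 8 * 2 ^ k by rewrite !expnS; lia.
have : C * 3 ^ (7 * 2 ^ k) <= 4 ^ (2 ^ k.+3).
  rewrite -sum_exp_weight -sum_nat_const big_mkcond /=; apply: leq_sum => e _.
  by rewrite inE; case: ifP => // le; rewrite leq_exp2l // E; lia.
rewrite E !expnM -[3 ^ 7]/(2187) -[4 ^ 8]/(65536) => h.
have p : 0 < 2187 ^ (2 ^ k) by rewrite expn_gt0.
rewrite -(leq_pmul2r p) -expnMn; apply: leq_trans h _.
by rewrite leq_exp2r ?expn_gt0.
Qed.

(* By Markov's inequality at least half of the words have few defects, and these
   words are determined by the automorphism, the jumps and the defects. *)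
Lemma word_count om levels M k h (P : finType)
    (lab : jumpT levels k.+3 * lampT k.+3 -> P) :
  om M = ord_max -> (forall n, sorted ltn (levels n)) ->
  (forall n j, n < k.+3 -> j \in levels n ->
    [&& n <= j, j.+1 < M & om j != ord_max]) ->
  (forall n, n < k.+3 -> h <= size (levels n)) -> k.+3 < M ->
  32 * k.+3 ^ 2 <= 2 ^ h ->
  (forall d e, size (word om (levels:=levels) (n:=k.+3) d e) < M) ->
  (forall p q, lab p = lab q ->
    wact om (word om (levels:=levels) (n:=k.+3) p.1 p.2) =1
    wact om (word om (levels:=levels) (n:=k.+3) q.1 q.2)) ->
  2 ^ 2 ^ k <= #|P|.
Proof.
move=> omM lv_s levelsP levels_size kM hk wM labP.
set J := #|jumpT levels k.+3|; set L := #|lampT k.+3|.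
pose def (p : jumpT levels k.+3 * lampT k.+3) :=
  defect om (levels:=levels) (n:=k.+3) M p.1 p.2 [::].
pose good := [pred p | weight (def p) <= 2 ^ k].
have S := sum_weight lv_s levelsP kM levels_size (leqnn k.+3).
(* The assumption on [h] brings the mean weight down to half of 2^k: 2 * 8 * k.+3 ^ 2 / 2 ^ h <= 1 /
   2. *)
have bad2 : 2 * #|[predC good]| <= J * L.
  have : (#|[predC good]| * 2 ^ k) * 2 ^ h <=
     2 * k.+3 ^ 2 * 2 ^ k.+3 * (J * L).
    apply: leq_trans S; rewrite leq_mul2r; apply/orP; right.
    rewrite -sum_nat_const big_mkcond pair_bigA /=; apply: leq_sum => p _.
    by rewrite !inE; case: ifP => //; rewrite -ltnNge => /ltnW.
  have -> : 2 * k.+3 ^ 2 * 2 ^ k.+3 * (J * L) = 2 ^ k * (16 * k.+3 ^ 2 * (J * L)).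
    by rewrite (expnS 2 k.+2) (expnS 2 k.+1) (expnS 2 k); lia.
  rewrite [_ * 2 ^ k]mulnC -mulnA leq_pmul2l ?expn_gt0 // => h1.
  have h2 : 2 * #|[predC good]| * 2 ^ h <= J * L * 2 ^ h.
    apply: (@leq_trans (32 * k.+3 ^ 2 * (J * L))); last by rewrite [J * L * _]mulnC leq_mul2r hk orbT.
    by rewrite -mulnA (leq_trans (leq_mul (leqnn 2) h1)) // !mulnA.
  by rewrite leq_pmul2r ?expn_gt0 // in h2.
have goodc : #|good| <= J * (#|P| * 32 ^ 2 ^ k).
  pose T := {e : lampT k.+3 | weight e <= 2 ^ k}.
  have cT : #|{: T}| <= 32 ^ 2 ^ k by rewrite card_sig; exact: card_light.
  have [->//|/card_gt0P[p0 p0g]] := posnP #|good|.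
  pose e0 : T := exist _ (def p0) p0g.
  apply: (@leq_trans #|{: jumpT levels k.+3 * (P * T)}|); last first.
    by rewrite card_prod [X in _ * X <= _]card_prod leq_mul // leq_mul.
  apply: (@leq_card_in _ _ (fun p => (p.1, (lab p, insubd e0 (def p))))).
  move=> [d e] [d' e']; rewrite !inE => pg qg [ed el ed']; subst d'; congr pair.
  have [] := @defect_inj om levels M omM k.+3 d e e' [::] [::]; rewrite ?cats0 //.
    exact: labP el.
  by move: (congr1 val ed'); rewrite !val_insubd pg qg.
have tot : #|good| + #|[predC good]| = J * L by rewrite cardC card_prod.
have J0 : 0 < J.
  by apply/card_gt0P; elim: (k.+3) => [|n [d _]]; [exists tt | 
     exists (d, (nseq_tuple _ true, nseq_tuple _ true), d)].
(* With t = 2^(2^k), [L] is t^8 and there are at most t^5 light defects, hence t^3 <= 2 * #|P|,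
   where t >= 2. *)
have : J * L <= 2 * (J * (#|P| * 32 ^ 2 ^ k)) by lia.
rewrite [2 * _]mulnCA leq_pmul2l // /L card_lampT.
have -> : 2 ^ 2 ^ k.+3 = (2 ^ 2 ^ k) ^ 8.
  by rewrite -expnM mulnC !expnS; congr expn; lia.
have -> : 32 ^ 2 ^ k = (2 ^ 2 ^ k) ^ 5 by rewrite -expnM mulnC expnM.
have : 2 <= 2 ^ 2 ^ k by rewrite -[X in X <= _]expn1 leq_exp2l // expn_gt0.
set t := 2 ^ 2 ^ k => t2.
rewrite (_ : t ^ 8 = t * t ^ 2 * t ^ 5); last by rewrite -expnS -expnD.
rewrite mulnA leq_pmul2r ?expn_gt0 ?(leq_trans _ t2) // => h1.
have t4 : 4 <= t ^ 2 by rewrite -[4]/(2 ^ 2) leq_exp2r.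
by have := leq_mul (leqnn t) t4; lia.
Qed.

(** * Words as elements of the group [grig om] *)

Definition kaut x om : taut := rec_aut (fun i => if kact i x then aut_a else 1%g) om.

Lemma tact_aut_a v : tact aut_a v = flip v.
Proof. by case: v => //= -[] v; rewrite ?tpermR ?tpermL. Qed.

Lemma tact_kaut x om v : tact (kaut x om) v = vact x om v.
Proof.
rewrite /kaut /=; elim: v om => //= -[] v IH om; first by rewrite IH.
by case: (kact _ _); rewrite ?tact_aut_a.
Qed.

Definition laut om (l : option klein) : taut := if l is Some x then kaut x om else aut_a.

Lemma tact_laut om l v : tact (laut om l) v = lact om l v.
Proof. by case: l => [x|]; [exact: tact_kaut | exact: tact_aut_a]. Qed.

Lemma lautK om l : (laut om l * laut om l = 1)%g.
Proof.
by apply: taut_eq => v; rewrite -[LHS]/(tact (laut om l) (tact (laut om l) v)) !tact_laut lactK.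
Qed.

Definition grig_gens om : set taut :=
  [set aut_a; aut_b om; aut_c om; aut_d om]%classic.

Lemma aut_bE om : aut_b om = kaut kb om.
Proof.
congr (rec_aut _ om); apply/funext => -[[|[|[]]] //]; by rewrite /ub.
Qed.

Lemma aut_cE om : aut_c om = kaut kc om.
Proof. by congr (rec_aut _ om); apply/funext => -[[|[|[]]] //]. Qed.

Lemma aut_dE om : aut_d om = kaut (false, true) om.
Proof. by congr (rec_aut _ om); apply/funext => -[[|[|[]]] //]. Qed.

Lemma kaut1 om : kaut (false, false) om = 1%g.
Proof.
apply: taut_eq => v; rewrite tact_kaut -[RHS]/v.
elim: v om => //= -[] v IH om; first by rewrite IH.
by case: (om 0) => -[|[|[]]].
Qed.

Lemma laut_grig om l : laut om l \in gen_set (grig_gens om).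
Proof.
have one t : grig_gens om t -> t \in gen_set (grig_gens om).
  move=> gt; rewrite inE; exists 1 => //; exists [:: t]; split=> //.
    by move=> z; rewrite inE => /eqP ->; left.
  by rewrite big_seq1.
case: l => [[[] []]|] /=.
- by apply: one; left; left; right; rewrite aut_bE.
- by apply: one; left; right; rewrite aut_cE.
- by apply: one; right; rewrite aut_dE.
- rewrite kaut1 inE; exists 0 => //; exists [::]; split=> //; by rewrite big_nil.
- by apply: one; left; left; left.
Qed.

Definition lgrig om l : grig om := GenType (laut_grig om l).

Lemma lgrigK om l : (lgrig om l * lgrig om l = 1)%g.
Proof. by apply: val_inj; rewrite valM val1 lautK. Qed.

Lemma ray_act_rho x om : ray_act rho (kaut x om) = rho.
Proof.
apply/funext => n; rewrite /ray_act tact_kaut.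
have -> : mkseq rho n.+1 = nseq n.+1 true.
  apply: (@eq_from_nth _ false); rewrite ?size_mkseq ?size_nseq // => i iN.
  by rewrite nth_mkseq // nth_nseq iN.
by rewrite vact_nseq nth_nseq ltnSn.
Qed.

(** * Generators of the group *)

Section Letters.
Variables (F : finGroupType) (om : nat -> 'I_3).
Notation X := (orbit_right_action om).
Notation Gam := (Gamma F om).
Local Open Scope group_scope.

Definition rhoX : X := exist _ rho (ex_intro2 _ _ 1 I (ray_act1 rho)).

Lemma X_eq (p q : X) : sval p = sval q -> p = q.
Proof. by case: p q => p hp [q hq] /= e; exact: eq_exist. Qed.

Definition at_point (p : X) (f : F) : X -> F :=
  fun q => if `[< q = p >] then f else 1.

Lemma at_point_fin p f : finite_set [set q | at_point p f q <> 1]%classic.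
Proof.
apply: (@sub_finite_set _ _ [set p]%classic) => // q /=.
by rewrite /at_point; case: asboolP.
Qed.

Definition letter_fun (l : option (klein * F)) : X -> F :=
  if l is Some (_, f) then at_point rhoX f else fun=> 1.

Lemma letter_fin l : finite_set [set q | letter_fun l q <> 1]%classic.
Proof.
case: l => [[x f]|]; first exact: at_point_fin.
by apply: (@sub_finite_set _ _ set0%classic) => // q /=.
Qed.

(** A lamp value at [rho] and an element of {1, b, c, d} form one generator. These elements fix
    [rho], so inverses and products of such generators are of the same kind. *)
Definition letter_val (l : option (klein * F)) : Gam :=
  Wreath (lgrig om (omap fst l)) (letter_fin l).

Definition letter_inv (l : option (klein * F)) : option (klein * F) :=
  omap (fun k => (k.1, k.2^-1)) l.

Lemma fix_rhoX x (q : X) : ra_act q (lgrig om (Some x)) = rhoX <-> q = rhoX.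
Proof.
have fixr : ra_act rhoX (lgrig om (Some x)) = rhoX.
  by apply: X_eq; exact: ray_act_rho.
split=> [e|->//].
have := congr1 (fun q : X => ra_act q (lgrig om (Some x))) e.
by rewrite fixr -ra_actM lgrigK ra_act1.
Qed.

Lemma letter_valK l : letter_val l * letter_val (letter_inv l) = 1.
Proof.
apply: wreath_eq => /=; last first.
  by case: l => [[x f]|]; exact: lgrigK.
apply/funext => q; case: l => [[x f]|] /=; last by rewrite mulg1.
rewrite /at_point; case: asboolP => [qr|qr]; case: asboolP => // qr'.
- by rewrite mulgV.
- by case: qr'; apply/(fix_rhoX x).
- by case: qr; apply/(fix_rhoX x).
- by rewrite mulg1.
Qed.

Lemma letter_valV l : (letter_val l)^-1 = letter_val (letter_inv l).
Proof. by apply: mulg1_eq; exact: letter_valK. Qed.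

Definition word_val (w : seq (option (klein * F))) : Gam :=
  \prod_(l <- w) letter_val l.

Lemma word_val_cat w1 w2 : word_val (w1 ++ w2) = word_val w1 * word_val w2.
Proof. exact: big_cat. Qed.

Lemma word_val_cons l w : word_val (l :: w) = letter_val l * word_val w.
Proof. exact: big_cons. Qed.

Lemma tact_word_val w v :
  tact (val (wr_grp (word_val w))) v = wact om (map (omap fst) w) v.
Proof.
elim: w v => [|l w IH] v; first by rewrite /word_val big_nil.
by rewrite word_val_cons /= IH tact_laut.
Qed.

Definition pure_letter (l : option klein) : option (klein * F) := omap (fun x => (x, 1)) l.

Lemma wr_fun_lift w : wr_fun (word_val (map pure_letter w)) = fun=> 1.
Proof.
elim: w => [|l w IH]; first by rewrite /word_val big_nil.
rewrite /= word_val_cons /=; apply/funext => q; rewrite IH mulg1.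
by case: l => //= x; rewrite /at_point; case: asboolP.
Qed.

Definition pure_grp (g : grig om) : Gam := Wreath g (wr_one_fin F X).

Lemma pure_grp_word g : exists w, pure_grp g = word_val w.
Proof.
have [w hw] : exists w, val g = \prod_(l <- w) laut om l.
  have := gen_valP g; rewrite inE => -[n _ [s [_ sS]]].
  rewrite -[gen_val g]/(val g) => ->.
  have lS t : grig_gens om t -> exists l, t = laut om l.
    case=> [[[]|]|] ->; [by exists None | | |].
    - by rewrite aut_bE; exists (Some kb).
    - by rewrite aut_cE; exists (Some kc).
    - by rewrite aut_dE; exists (Some (false, true)).
  elim: s sS => [|t s IH] sS; first by exists [::]; rewrite !big_nil.
  have [z zs|w hw] := IH; first by apply: sS; rewrite inE zs orbT.
  have [l ->] : exists l, t = laut om l.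
    have [/lS//|/lS [l tl]] := sS t (mem_head _ _).
    by exists l; rewrite -[t]invgK tl; apply: mulg1_eq; exact: lautK.
  by exists (l :: w); rewrite !big_cons hw.
exists (map pure_letter w); apply: wreath_eq => /=; first by rewrite wr_fun_lift.
apply: val_inj; apply: (etrans hw); elim: w {hw} => [|l w IH].
  by rewrite /word_val !big_nil.
rewrite big_cons IH /= word_val_cons /=; congr (laut _ _ * _).
by case: l.
Qed.

Definition represented (u : Gam) := exists w, u = word_val w.

Lemma represented_mul u u' : represented u -> represented u' -> represented (u * u').
Proof. by move=> [w ->] [w' ->]; exists (w ++ w'); rewrite word_val_cat. Qed.

Definition lamp (p : X) (f : F) : Gam := Wreath 1 (at_point_fin p f).

(** Conjugate the lamp at [rho] by an element that carries [rho] to [p]. *)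
Lemma represented_lamp p f : represented (lamp p f).
Proof.
have [h _ hp] := svalP p.
have -> : lamp p f = pure_grp h^-1 * (letter_val (Some ((false, false), f)) * pure_grp h).
  apply: wreath_eq => /=.
    apply/funext => q; rewrite mul1g mulg1 /at_point; congr (if _ then _ else _).
    have hpX : orbit_ract rhoX h = p by exact: X_eq.
    apply/asbool_equiv_eq; split=> [->|e].
      by rewrite -hpX -orbit_ractM mulgV orbit_ract1.
    by rewrite -hpX -e -orbit_ractM mulVg orbit_ract1.
  suff -> : lgrig om (Some (false, false)) = 1 by rewrite mul1g mulVg.
  by apply: val_inj; rewrite /= kaut1.
by apply: represented_mul; [|apply: represented_mul];
  [exact: pure_grp_word | exists [:: Some ((false, false), f)]; rewrite /word_val big_seq1
  | exact: pure_grp_word].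
Qed.

Lemma all_represented (u : Gam) : represented u.
Proof.
have [s hs] : exists s : seq (nat -> bool), forall q, wr_fun u q <> 1 -> sval q \in s.
  have : finite_set [set sval q | q in [set q : X | wr_fun u q <> 1]]%classic.
    by apply: finite_image; exact: wr_fin.
  by case/finite_seqP => s e; exists s => q uq; have : [set` s]%classic (sval q) by rewrite -e; exists q.
elim: s u hs => [|p s IH] u hs.
  have -> : u = pure_grp (wr_grp u).
    apply: wreath_eq => //=; apply/funext => q.
    by have [//|/hs] := pselect (wr_fun u q = 1).
  exact: pure_grp_word.
have [[p' pp']|np] := pselect (exists p' : X, sval p' = p); last first.
  apply: IH => q uq; have := hs q uq; rewrite inE => /predU1P[e|//].
  by case: np; exists q.
pose f := wr_fun u p'.
have -> : u = lamp p' f * (lamp p' f^-1 * u).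
  rewrite mulgA; suff -> : lamp p' f * lamp p' f^-1 = 1 by rewrite mul1g.
  apply: wreath_eq => /=; last by rewrite mulg1.
  apply/funext => q; rewrite orbit_ract1 /at_point.
  by case: asboolP => _; rewrite ?mulgV ?mulg1.
apply: represented_mul; first exact: represented_lamp.
apply: IH => q /=; rewrite orbit_ract1 /at_point; case: asboolP => [->|qp].
  by rewrite mulVg.
rewrite mul1g => /hs; rewrite inE => /predU1P[e|//].
by case: qp; apply: X_eq; rewrite e.
Qed.

Definition letters : {fset Gam} := [fset letter_val l | l in {: option (klein * F)}]%fset.

Lemma word_val_ball w n : (size w <= n)%N -> word_ball [set` letters]%classic n (word_val w).
Proof.
move=> wn; exists (map letter_val w); split; rewrite ?size_map //; last by rewrite /word_val big_map.
move=> _ /mapP[l _ ->]; left; rewrite /=; apply/imfsetP; by exists l.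
Qed.

Lemma ball_word_val n u : word_ball [set` letters]%classic n u ->
  exists2 w, (size w <= n)%N & u = word_val w.
Proof.
case=> s [sn sS ->]; elim: s n sn sS => [|t s IH] n sn sS.
  by exists [::] => //; rewrite /word_val !big_nil.
case: n sn => // n; rewrite ltnS => /IH [z zs|w wn hw]; first by apply: sS; rewrite inE zs orbT.
have [l ->] : exists l, t = letter_val l.
  have lS z : [set` letters]%classic z -> exists l, z = letter_val l.
    by rewrite /= => /imfsetP[l _ ->]; exists l.
  have [/lS//|/lS [l tl]] := sS t (mem_head _ _).
  by exists (letter_inv l); rewrite -letter_valV -tl invgK.
by exists (l :: w) => //; rewrite /word_val !big_cons hw.
Qed.

Lemma generates_letters : generates letters.
Proof.
apply/seteqP; split=> // u _; have [w ->] := all_represented u.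
by exists (size w) => //; exact: word_val_ball.
Qed.

End Letters.

(** * Upper bound *)

Definition rshift (p : nat -> bool) : nat -> bool := fun n => p n.+1.

Lemma mkseqSr (p : nat -> bool) n : mkseq p n.+1 = p 0 :: mkseq (rshift p) n.
Proof. by rewrite /mkseq /= -[1]add1n iotaDl -map_comp. Qed.

Lemma ray_act_a0 p : ray_act p aut_a 0 = ~~ p 0.
Proof. by rewrite /ray_act tact_aut_a. Qed.

Lemma ray_act_aS p : rshift (ray_act p aut_a) = rshift p.
Proof.
by apply/funext => n; rewrite /rshift /ray_act tact_aut_a mkseqSr /= nth_mkseq.
Qed.

Lemma ray_act_k0 p x om : ray_act p (kaut x om) 0 = p 0.
Proof. by rewrite /ray_act tact_kaut. Qed.

Lemma ray_act_kS p x om : rshift (ray_act p (kaut x om)) =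
  if p 0 then ray_act (rshift p) (kaut x (wshift om))
  else if kact (om 0) x then ray_act (rshift p) aut_a else rshift p.
Proof.
apply/funext => n; rewrite /rshift {1}/ray_act tact_kaut mkseqSr /=.
case: (p 0); first by rewrite /ray_act tact_kaut.
case: (kact _ _); first by rewrite /ray_act tact_aut_a.
by rewrite nth_mkseq.
Qed.

Lemma rho_split p : (p = rho) <-> p 0 /\ rshift p = rho.
Proof.
split=> [->//|[p0 ps]]; apply/funext => -[|n]; first by rewrite p0.
by have := congr1 (fun q => q n) ps.
Qed.

Section Code.
Variable F : finGroupType.
Notation letter := (option (klein * F)).
Implicit Types (w : seq letter) (p : nat -> bool).

Definition act_word om w := wact om (map (omap fst) w).

Definition at_rho p (f : F) : F := if `[< p = rho >] then f else 1%g.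

Fixpoint lamps om w p : F :=
  if w is l :: w' then
    if l is Some (x, f) then (at_rho p f * lamps om w' (ray_act p (kaut x om)))%g
    else lamps om w' (ray_act p aut_a)
  else 1%g.

Lemma wr_fun_word_val om w (q : orbit_right_action om) :
  wr_fun (word_val om w) q = lamps om w (sval q).
Proof.
elim: w q => [|l w IH] q; first by rewrite /word_val big_nil.
rewrite word_val_cons /=; rewrite IH; case: l => [[x f]|] /=; last by rewrite mul1g.
congr (_ * _)%g; rewrite /at_point /at_rho; congr (if _ then _ else _).
by apply/asbool_equiv_eq; split=> [->//|e]; exact: X_eq.
Qed.

(** Since [rho] is 1 followed by [rho], lamps go to the section at 1; a letter met at 0 leaves [a]
    or nothing. *)
Fixpoint section_word om (t : bool) w : seq letter :=
  if w is l :: w' then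
    if l is Some (x, f) then
      if t then Some (x, f) :: section_word om t w'
      else if kact (om 0) x then None :: section_word om t w' else section_word om t w'
    else section_word om (~~ t) w'
  else [::].

Definition swaps w : bool := odd (count (pred1 None) w).

Lemma act_word_sec om w t v :
  act_word om w (t :: v) = (t (+) swaps w) :: act_word (wshift om) (section_word om t w) v.
Proof.
rewrite /act_word /swaps; elim: w t v => [|[[x f]|] w IH] t v /=.
- by rewrite addbF.
- by rewrite IH; case: t => //=; case: (kact _ _).
- by rewrite IH addbN -addNb.
Qed.

Lemma lamps_sec om w p :
  lamps om w p = lamps (wshift om) (section_word om (p 0) w) (rshift p).
Proof.
elim: w p => [|[[x f]|] w IH] p //=; last first.
  by rewrite IH ray_act_a0 ray_act_aS.
rewrite IH ray_act_k0 ray_act_kS.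
have -> : at_rho p f = if p 0 then at_rho (rshift p) f else 1%g.
  rewrite /at_rho; case: asboolP => [/rho_split [-> ->]|np].
    by rewrite asboolT.
  by case p0: (p 0) => //; case: asboolP => // e; case: np; apply/rho_split.
by case: (p 0) => //=; rewrite mul1g; case: (kact _ _).
Qed.

(** Only neighbours other than [a] are merged. Repetitions of [a] may stay: the estimates use that
    each other letter, except possibly the last, is followed by an [a]. *)
Fixpoint norm w : seq letter :=
  if w is l :: w' then
    if l is Some (x, f) then
      if norm w' is Some (y, g) :: w'' then Some (kmul x y, (f * g)%g) :: w''
      else Some (x, f) :: norm w'
    else None :: norm w'
  else [::].

Lemma vact_kmul x y om v : vact (kmul x y) om v = vact y om (vact x om v).
Proof.
elim: v om => //= -[] v IH om /=; first by rewrite IH.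
by rewrite kact_add; case: (kact _ x); case: (kact _ y); rewrite ?flipK.
Qed.

Lemma kaut_kmul x y om : kaut (kmul x y) om = (kaut x om * kaut y om)%g.
Proof.
apply: taut_eq => v; rewrite -[RHS]/(tact (kaut y om) (tact (kaut x om) v)).
by rewrite !tact_kaut vact_kmul.
Qed.

Lemma act_word_norm om w v : act_word om (norm w) v = act_word om w v.
Proof.
have cons l u z : act_word om (l :: u) z = act_word om u (lact om (omap fst l) z) by [].
elim: w v => [|[[x f]|] w IH] v //; rewrite [RHS]cons -IH //= .
by case: (norm w) => [|[[y g]|] w'] //=; rewrite !cons /= vact_kmul.
Qed.

Lemma lamps_norm om w p : lamps om (norm w) p = lamps om w p.
Proof.
elim: w p => [|[[x f]|] w IH] p //=.
have := IH (ray_act p (kaut x om)); case: (norm w) => [|[[y g]|] w'] //= <- //.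
rewrite kaut_kmul ray_actM mulgA; congr (_ * _)%g; rewrite /at_rho.
case: asboolP => [->|np]; first by rewrite ray_act_rho asboolT.
rewrite mul1g asboolF // => e; apply: np.
rewrite -(ray_act1 p) -[1%g](lautK om (Some x)) ray_actM e; exact: ray_act_rho.
Qed.

Fixpoint alternating w : bool :=
  if w is l :: w' then
    alternating w' && ((l == None) || (if w' is l' :: _ then l' == None else true))
  else true.

Lemma norm_alternating w : alternating (norm w).
Proof.
elim: w => [|[[x f]|] w IH] //=; last by rewrite IH.
by move: IH; case: (norm w) => [|[[y g]|] w'] //= ->.
Qed.

Lemma alternating_count w : alternating w ->
  count predT w <= (count (pred1 None) w).*2 + (if w is Some _ :: _ then 1 else 0).
Proof.
elim: w => [|[k|] w IH] //= /andP[/IH {IH}]; last by case: w => [|[k|] w] /=; lia.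
by case: w => [|[k'|] w] //=; lia.
Qed.

Notation value := ((seq bool -> seq bool) * ((nat -> bool) -> F))%type.

Definition value_of om w : value := (act_word om w, lamps om w).

Definition join_values (b : bool) (u0 u1 : value) : value :=
  ((fun v => if v is t :: y then (t (+) b) :: (if t then u1.1 y else u0.1 y) else [::]),
   (fun p => if p 0 then u1.2 (rshift p) else u0.2 (rshift p))).

Lemma value_sec om w : value_of om w = join_values (swaps w)
  (value_of (wshift om) (section_word om false w)) (value_of (wshift om) (section_word om true w)).
Proof.
congr pair; apply/funext.
  move=> [|t v] /=; first by apply/eqP; rewrite -size_eq0 size_wact.
  by rewrite act_word_sec; case: t.
by move=> p; rewrite lamps_sec /=; case: (p 0).
Qed.

Lemma value_norm om w : value_of om (norm w) = value_of om w.
Proof.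
by congr pair; apply/funext; [exact: act_word_norm | exact: lamps_norm].
Qed.

(* A leaf is a word closed by [None]; an inner node starts with one symbol that
   tells whether the two subtrees are exchanged. *)
Fixpoint decode n om (s : seq (option letter)) : value * seq (option letter) :=
  if n is n'.+1 then
    let: (u0, s0) := decode n' (wshift om) (behead s) in
    let: (u1, s1) := decode n' (wshift om) s0 in
    (join_values (head None s == None) u0 u1, s1)
  else let i := index None s in (value_of om (pmap id (take i s)), drop i.+1 s).

Lemma decode0 om w s : decode 0 om (map Some w ++ None :: s) = (value_of om w, s).
Proof.
rewrite /= (_ : index _ _ = size w); last first.
  rewrite index_cat; case: ifP => [/mapP[] //|_]; by rewrite size_map /= addn0.
by rewrite take_size_cat ?size_map // drop_cat size_map ltnNge leqnSn subSnn /= drop0 map_pK.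
Qed.

(** * Weights of sections and length of codes *)

Section Weights.
Variable R : realFieldType.
Local Open Scope ring_scope.

Definition letter_weight (wt : klein -> R) (l : letter) : R :=
  if l is Some (x, _) then wt x else 1.

Definition word_weight wt w : R := \sum_(l <- w) letter_weight wt l.

Lemma word_weight_norm wt w : (forall x y, wt (kmul x y) <= wt x + wt y) ->
  word_weight wt (norm w) <= word_weight wt w.
Proof.
move=> wtD; rewrite /word_weight; elim: w => [|[[x f]|] w IH] //=; rewrite ?big_cons ?lerD2l //.
case: (norm w) IH => [|[[y g]|] w'] IH; rewrite [leLHS]big_cons ?lerD2l //=.
by move: IH; rewrite !big_cons /=; have := wtD x y; lra.
Qed.

Lemma word_weight_cons wt l w :
  word_weight wt (l :: w) = letter_weight wt l + word_weight wt w.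
Proof. exact: big_cons. Qed.

Lemma word_weight_nil wt : word_weight wt [::] = 0.
Proof. exact: big_nil. Qed.

Definition letter_sum (f : klein -> R) w : R :=
  \sum_(l <- w) (if l is Some (x, _) then f x else 0).

Lemma word_weight_sec om wt w :
  word_weight wt (section_word om false w) + word_weight wt (section_word om true w) =
  letter_sum (fun x => (kact (om 0%N) x)%:R + wt x) w.
Proof.
rewrite /letter_sum.
pose f (l : letter) := if l is Some (x, _) then (kact (om 0%N) x)%:R + wt x else 0.
(* Both orders of the sections are treated together, because [a] exchanges them. *)
have [] : word_weight wt (section_word om false w) + word_weight wt (section_word om true w) =
   \sum_(l <- w) f l /\
   word_weight wt (section_word om true w) + word_weight wt (section_word om false w) =
   \sum_(l <- w) f l; last by [].
elim: w => [|[[x g]|] w [IH1 IH2]] /=; rewrite ?big_cons ?big_nil ?word_weight_nil ?addr0 //.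
  by rewrite /f -IH1; case: (kact _ _); rewrite /= !word_weight_cons /=; split; lra.
by rewrite add0r.
Qed.

(** Each letter other than [a] is charged the weight 1 of the [a] after it; the final [+ 1] is for a
    last letter without successor. *)
Lemma letter_sum_alternating wt w : alternating w ->
  letter_sum (fun x => 1 + wt x) w <= word_weight wt w + 1.
Proof.
move=> alt; suff : letter_sum (fun x => 1 + wt x) w <=
    word_weight wt w + (if w is Some _ :: _ then 1 else 0).
  by case: w {alt} => [|[k|] w]; lra.
rewrite /letter_sum; elim: w alt => [|[[x f]|] w IH] /=.
- by rewrite big_nil word_weight_nil addr0.
- case/andP => /IH {}IH nw; rewrite big_cons word_weight_cons /=.
  have e : (if w is Some _ :: _ then 1 else 0) = 0 :> R.
    by case: w nw {IH} => [|[]].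
  by rewrite e in IH; lra.
- case/andP => /IH {}IH _; rewrite big_cons word_weight_cons /=.
  by case: w IH => [|[k|] w] IH; lra.
Qed.

Lemma word_weight_sec_le om wt wt' eta w : 0 <= eta ->
  (forall x, (kact (om 0%N) x)%:R + wt' x <= eta * (1 + wt x)) ->
  alternating w ->
  word_weight wt' (section_word om false w) + word_weight wt' (section_word om true w) <=
  eta * (word_weight wt w + 1).
Proof.
move=> eta0 wtP alt; rewrite word_weight_sec.
apply: le_trans (ler_wpM2l eta0 (letter_sum_alternating wt alt)).
by rewrite /letter_sum mulr_sumr; apply: ler_sum => -[[x f]|] _ //; rewrite mulr0.
Qed.

Lemma size_alternating wt w : (forall x, 0 <= wt x) -> alternating w ->
  (size w)%:R <= 2 * word_weight wt w + 1.
Proof.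
move=> wt0 /alternating_count; rewrite count_predT => sw.
have h : (count (pred1 None) w)%:R <= word_weight wt w.
  rewrite /word_weight; elim: w {sw} => [|[[x f]|] w IH] /=; rewrite ?big_nil ?big_cons //=.
    by rewrite add0n; have := wt0 x; lra.
  by rewrite add1n -natr1 addrC lerD2l.
have : (size w <= (count (pred1 None) w).*2.+1)%N.
  by apply: leq_trans sw _; case: (w) => [|[k|] w'] /=; rewrite ?addn1 ?addn0.
by rewrite -(ler_nat R) -addn1 -muln2 natrD natrM; lra.
Qed.

(** The margin [+ 3] closes the induction: the subtrees bring it twice, and 6 = 3 + 1 + 2 covers the
    symbol of the node and the additive term of [word_weight_sec_le], which counts for at most 2. *)
Lemma decode_exists n om (wt : nat -> klein -> R) (eta : nat -> R) w :
  (forall i x, 0 <= wt i x) ->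
  (forall i x y, wt i (kmul x y) <= wt i x + wt i y) ->
  (forall i, 0 <= eta i <= 1) ->
  (forall i x, (kact (om i) x)%:R + wt i.+1 x <= eta i * (1 + wt i x)) ->
  exists s, (size s)%:R + 3 <=
      2 * (\prod_(i < n) eta i) * word_weight (wt 0%N) w + 5 * 2 ^+ n /\
    forall r, decode n om (s ++ r) = (value_of om w, r).
Proof.
elim: n om wt eta w => [|n IH] om wt eta w wt0 wtD etaP wtP.
  exists (map Some (norm w) ++ [:: None]); split; last first.
    by move=> r; rewrite -catA decode0 value_norm.
  rewrite size_cat size_map natrD big_ord0 expr0 /=.
  have := size_alternating (wt0 0%N) (norm_alternating w).
  have := word_weight_norm w (wtD 0%N); lra.
pose w0 := section_word om false (norm w); pose w1 := section_word om true (norm w).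
have IH' u := IH (wshift om) (fun i => wt i.+1) (fun i => eta i.+1) u
  (fun i => wt0 i.+1) (fun i => wtD i.+1) (fun i => etaP i.+1) (fun i => wtP i.+1).
have [s0 [sz0 d0]] := IH' w0; have [s1 [sz1 d1]] := IH' w1.
exists ((if swaps (norm w) then None else Some None) :: s0 ++ s1); split; last first.
  move=> r; rewrite /= -catA d0 d1 -(value_norm om w) (value_sec om (norm w)).
  by case: (swaps _).
have /andP[e0 e1] := etaP 0%N.
have := word_weight_sec_le e0 (wtP 0%N) (norm_alternating w).
rewrite -/w0 -/w1 => hw; have nw := word_weight_norm w (wtD 0%N).
rewrite /= size_cat -natr1 natrD big_ord_recl /=.
set P := \prod_(i < n) _ in sz0 sz1 *.
have P0 : 0 <= P by apply: prodr_ge0 => i _; case/andP: (etaP i.+1).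
have P1 : P <= 1 by apply: prodr_ile1 => i _; exact: etaP.
set a := word_weight _ w0 in sz0 hw; set b := word_weight _ w1 in sz1 hw.
set c := word_weight _ w in nw *; set d := word_weight _ (norm w) in nw hw.
have h1 : P * (a + b) <= P * (eta 0%N * (c + 1)).
  apply: ler_wpM2l => //; apply: le_trans hw _; apply: ler_wpM2l => //; lra.
have h2 : P * eta 0%N <= 1 by rewrite mulr_ile1.
rewrite exprS; move: h1 h2 sz0 sz1; rewrite !mulrDr mulr1.
set t := 2 ^+ n.
have -> : P * (eta 0%N * c) = eta 0%N * P * c by ring.
lra.
Qed.
End Weights.
End Code.

(** * Word balls and change of generating set *)

Section Balls.
Variable G : groupType.
Implicit Types (S T : {fset G}) (A : set G).
Local Open Scope group_scope.

Lemma word_ball_mono A m n u : (m <= n)%N -> word_ball A m u -> word_ball A n u.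
Proof. by move=> mn [s [sm sS ->]]; exists s; split=> //; exact: leq_trans mn. Qed.

Lemma word_ball_mul A m n u u' :
  word_ball A m u -> word_ball A n u' -> word_ball A (m + n) (u * u').
Proof.
move=> [s [sm sS ->]] [t [tn tS ->]]; exists (s ++ t); split; last by rewrite big_cat.
  by rewrite size_cat leq_add.
by move=> z; rewrite mem_cat => /orP[/sS|/tS].
Qed.

Lemma word_ball_inv A n u : word_ball A n u -> word_ball A n u^-1.
Proof.
move=> [s [sn sS ->]]; elim: s n sn sS => [|z s IH] n sn sS.
  by rewrite big_nil invg1; exists [::]; rewrite big_nil.
case: n sn => // n; rewrite ltnS => sn.
rewrite big_cons invgM -addn1; apply: word_ball_mul.
  by apply: IH => // y ys; apply: sS; rewrite inE ys orbT.
exists [:: z^-1]; split=> //; last by rewrite big_seq1.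
move=> y; rewrite inE => /eqP ->; rewrite invgK.
by have [] := sS z (mem_head _ _); [right | left].
Qed.

Lemma word_ball_change S T : generates T ->
  exists c, forall n u, word_ball [set` S]%classic n u ->
    word_ball [set` T]%classic (c * n) u.
Proof.
move=> gT.
have [c hc] : exists c, forall z, z \in S -> word_ball [set` T]%classic c z.
  have : forall s : seq G, exists c, forall z, z \in s -> word_ball [set` T]%classic c z.
    elim=> [|z s [c hc]]; first by exists 0%N.
    have : gen_set [set` T]%classic z by rewrite gT.
    case=> m _ hz; exists (maxn m c) => y; rewrite inE => /predU1P[->|/hc h].
      exact: word_ball_mono (leq_maxl _ _) hz.
    exact: word_ball_mono (leq_maxr _ _) h.
  by move/(_ (enum_fset S)).
exists c => n u [s [sn sS ->]]; elim: s n sn sS => [|z s IH] n sn sS.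
  by rewrite big_nil; exists [::]; rewrite big_nil.
case: n sn => // n; rewrite ltnS => sn; rewrite big_cons mulnS.
apply: word_ball_mul; last by apply: IH => // y ys; apply: sS; rewrite inE ys orbT.
have [zS|zS] := sS z (mem_head _ _); first exact: hc.
by rewrite -[z]invgK; apply: word_ball_inv; exact: hc.
Qed.

Lemma finite_fset_ball S n : finite_set (word_ball [set` S]%classic n).
Proof. exact/finite_word_ball/finite_fset. Qed.

Lemma in_growth S n u : (u \in fset_set (word_ball [set` S]%classic n)) =
  (u \in word_ball [set` S]%classic n).
Proof. by rewrite in_fset_set //; exact: finite_fset_ball. Qed.

Lemma growth_le S T m n :
  (forall u, word_ball [set` S]%classic m u -> word_ball [set` T]%classic n u) ->
  (growth S m <= growth T n)%N.
Proof.
move=> ST; apply/fsubset_leq_card/fsubsetP => u; rewrite !in_growth !inE; exact: ST.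
Qed.

Lemma growth_change S T : generates T ->
  exists2 c, (0 < c)%N & forall n, (growth S n <= growth T (c * n))%N.
Proof.
move=> gT; have [c hc] := word_ball_change S gT; exists c.+1 => // n.
apply: growth_le => u /hc; apply: word_ball_mono; by rewrite leq_mul2r leqnSn orbT.
Qed.

Lemma growth_le_card S n (C : finType) (D : Type) (val : G -> D) (dec : C -> D) :
  injective val ->
  (forall u, word_ball [set` S]%classic n u -> exists c, dec c = val u) ->
  (growth S n <= #|C|)%N.
Proof.
move=> vi h; set A := fset_set (word_ball [set` S]%classic n).
have /choice[f hf] : forall u : A, exists c, dec c = val (fsval u).
  by move=> u; apply: h; have := fsvalP u; rewrite in_growth inE.
rewrite /growth -/A cardfE; apply: (leq_card f) => u u' e.
by apply/val_inj/vi; rewrite -!hf e.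
Qed.

(** Stated for arbitrary labels in order to match [word_count]; the labels used are the points of
    the ball. *)
Lemma growth_ge_card S n (C : finType) (f : C -> G) k :
  (forall c, word_ball [set` S]%classic n (f c)) ->
  (forall (P : finType) (lab : C -> P), (forall c c', lab c = lab c' -> f c = f c') ->
    (k <= #|P|)%N) ->
  (k <= growth S n)%N.
Proof.
move=> fB h; set A := fset_set (word_ball [set` S]%classic n).
have fA c : f c \in A by rewrite in_growth inE.
rewrite /growth -/A cardfE; apply: (h _ (fun c => [` fA c]%fset)) => c c'.
by move/(congr1 val).
Qed.

End Balls.

Section GammaGrowth.
Variables (F : finGroupType) (om : nat -> 'I_3).
Notation Gam := (Gamma F om).
Notation letter := (option (klein * F)).

Definition gam_value (u : Gam) :=
  ((fun v => tact (val (wr_grp u)) v),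
   (fun q : orbit_right_action om => wr_fun u q)).

Lemma gam_value_inj : injective gam_value.
Proof.
move=> u u' [e1 e2]; apply: wreath_eq => //; apply: val_inj; apply: taut_eq => v.
by have := congr1 (fun f => f v) e1.
Qed.

Lemma growth_letters_le (R : realFieldType) n r (wt : nat -> klein -> R) (eta : nat -> R) (c : R) :
  (forall i x, 0 <= wt i x)%R ->
  (forall i x y, wt i (kmul x y) <= wt i x + wt i y)%R ->
  (forall i, 0 <= eta i <= 1)%R ->
  (forall i x, (kact (om i) x)%:R + wt i.+1 x <= eta i * (1 + wt i x))%R ->
  (1 <= c)%R -> (forall x, wt 0 x <= c)%R ->
  ((\prod_(i < n) eta i) * (c * r%:R) <= 2 ^+ n)%R ->
  growth (letters F om) r <= (#|{: letter}|.+1) ^ (8 * 2 ^ n).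
Proof.
move=> wt0 wtD etaP wtP c1 wc hn.
rewrite -[X in X ^ _]card_option -card_tuple.
pose dec (s : (8 * 2 ^ n).-tuple (option letter)) :=
  let u := (decode n om s).1 in
  ((fun v => u.1 v), (fun q : orbit_right_action om => u.2 (sval q))).
apply: (growth_le_card (val := gam_value) (dec := dec)); first exact: gam_value_inj.
move=> u /ball_word_val [w wr ->].
have [s [sz ds]] := @decode_exists F R n om wt eta w wt0 wtD etaP wtP.
have sN : size s <= 8 * 2 ^ n.
  rewrite -(ler_nat R) natrM natrX.
  have hw : (word_weight (wt 0) w <= c * r%:R)%R.
    apply: (@le_trans _ _ (\sum_(l <- w) c)%R).
      by apply: ler_sum => -[[x f]|] _ //=.
    rewrite big_const_seq count_predT iter_addr_0 -[(c *+ _)%R]mulr_natr.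
    by rewrite ler_wpM2l ?ler_nat // (le_trans _ c1).
  have P0 : (0 <= \prod_(i < n) eta i)%R by apply: prodr_ge0 => i _; case/andP: (etaP i).
  have := ler_wpM2l P0 hw; set t := (2 ^+ n)%R in sz hn *.
  have : (0 <= t)%R by rewrite exprn_ge0.
  move: sz hn; rewrite -!mulrA; lra.
(* The code has length at most 7 * 2^n, and [decode] leaves the padding as remainder. *)
have sz' : size (s ++ nseq (8 * 2 ^ n - size s) None) == 8 * 2 ^ n.
  by rewrite size_cat size_nseq subnKC.
exists (Tuple sz'); rewrite /dec /= ds /gam_value; congr pair.
  by apply/funext => v; rewrite tact_word_val.
by apply/funext => q; rewrite wr_fun_word_val.
Qed.
End GammaGrowth.

(** * The sequence omega *)

Definition nxt (i : 'I_3) : 'I_3 := inord ((val i).+1 %% 3).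

Lemma val_nxt i : val (nxt i) = (val i).+1 %% 3.
Proof. by rewrite /nxt /= inordK // ltn_mod. Qed.

Lemma kactE i x : kact i x =
  if val i == 0 then x.1 else if val i == 1 then x.2 else x.1 (+) x.2.
Proof. by rewrite /kact; case: (val i) => [|[|]]. Qed.

Section Pattern.
Variable t : nat -> bool.

(** Choosing the regime for three levels at a time makes every run of 012012... stop after a 2,
    where the next letter is 0 in both regimes; hence [pattern_next] consults [t] only at the level
    being left. *)
Definition pattern (n : nat) : 'I_3 := if t (n %/ 3) then inord (n %% 3) else ord0.

Lemma val_pattern n : val (pattern n) = if t (n %/ 3) then n %% 3 else 0.
Proof. by rewrite /pattern; case: (t _) => //; rewrite /= inordK // ltn_mod. Qed.

Lemma pattern_next n :
  pattern n.+1 = if t (n %/ 3) then nxt (pattern n) else pattern n.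
Proof.
apply: val_inj; rewrite val_pattern.
have [e|e] := eqVneq (n.+1 %/ 3) (n %/ 3).
  rewrite e; case: ifP => tn; last by rewrite val_pattern tn.
  by rewrite val_nxt val_pattern tn; lia.
have -> : n.+1 %% 3 = 0 by lia.
have n2 : n %% 3 = 2 by lia.
rewrite if_same; case: ifP => tn; last by rewrite val_pattern tn.
by rewrite val_nxt val_pattern tn n2.
Qed.

Lemma pattern_max n : (pattern n == ord_max) = t (n %/ 3) && (n %% 3 == 2).
Proof. by rewrite -val_eqE val_pattern; case: (t _). Qed.

Lemma pattern_sep n : pattern n = ord_max -> pattern n.+1 != ord_max.
Proof. by move/eqP; rewrite !pattern_max => /andP[_ /eqP n2]; lia. Qed.

End Pattern.

Section Weights.
Variables (R : realFieldType) (eta : R).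
Local Open Scope ring_scope.
Hypotheses (eta0 : 0 < eta) (eta1 : eta < 1) (etaE : eta ^+ 3 + eta ^+ 2 + eta = 2).

(* [p], [q] and [r] are the values on the letters of {b, c, d} that act trivially
   at the current level, at the next one and at the one after in 012012... *)
Definition by_phase (z p q r : R) (i : 'I_3) x : R :=
  if x == (false, false) then z else if ~~ kact i x then p
  else if ~~ kact (nxt i) x then q else r.

Let K := (1 - eta ^+ 3)^-1.

Lemma weights_denominator : K * (1 - eta ^+ 3) = 1.
Proof. by rewrite mulVf // subr_eq0 eq_sym lt_eqF // exprn_ilt1 // ltW. Qed.

(* With A the weight 1 of a, the vector (A + p, A + q, A + r) is proportional to
   (eta^2, eta, 1), and r = p + q is the equation satisfied by eta. *)
Definition contracting : 'I_3 -> klein -> R :=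
  by_phase 0 (eta ^+ 2 * K - 1) (eta * K - 1) (K - 1).

Lemma weights_ge1 : 1 <= eta ^+ 2 * K /\ eta ^+ 2 * K <= eta * K /\ eta * K <= K.
Proof.
have k0 : 0 < 1 - eta ^+ 3 by rewrite subr_gt0 exprn_ilt1 // ltW.
have K0 : 0 < K by rewrite invr_gt0.
split; last split.
- rewrite -weights_denominator mulrC ler_wpM2r ?(ltW K0) //; move: (etaE) (eta1); lra.
- by rewrite ler_wpM2r ?(ltW K0) // expr2 ler_piMl // ltW.
- by rewrite ler_piMl ?(ltW K0) // ltW.
Qed.

Lemma contracting_ge0 i x : 0 <= contracting i x.
Proof.
have [h1 [h2 h3]] := weights_ge1; rewrite /contracting /by_phase.
by case: ifP => // _; case: ifP => _; [lra | case: ifP => _; lra].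
Qed.

Lemma contracting_le i x : contracting i x <= K.
Proof.
have [h1 [h2 h3]] := weights_ge1; rewrite /contracting /by_phase.
by case: ifP => // _; [|case: ifP => _; [|case: ifP => _]]; lra.
Qed.

Lemma weights_sum : eta ^+ 2 * K - 1 + (eta * K - 1) = K - 1.
Proof.
have := weights_denominator; move: (etaE); rewrite !expr2 !exprS expr0 mulr1 => e1 e2.
have : K * (eta * (eta * eta) + eta * eta + eta) = K * 2 by rewrite e1.
lra.
Qed.

Lemma contracting_kmul i x y :
  contracting i (kmul x y) <= contracting i x + contracting i y.
Proof.
have [h1 [h2 h3]] := weights_ge1; have h4 := weights_sum; rewrite /contracting /by_phase !kactE !val_nxt.
by case: i => -[|[|[]]] // ilt; case: x => [[] []]; case: y => [[] []]; rewrite /=; lra.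
Qed.

(** For b, c, d these are equalities. One level moves phase r to q, q to p and p to r: 1 + q = eta
    (1 + r), 1 + p = eta (1 + q), and r = eta (1 + p) because eta^3 K = K - 1. *)
Lemma contracting_next i x :
  (kact i x)%:R + contracting (nxt i) x <= eta * (1 + contracting i x).
Proof.
have h := weights_denominator; have h4 := weights_sum; have [h1 [h2 h3]] := weights_ge1.
have e2 : eta * (eta ^+ 2 * K) = K - 1 by rewrite mulrA -exprS; lra.
have e1 : eta * (eta * K) = eta ^+ 2 * K by rewrite mulrA -expr2.
rewrite /contracting /by_phase !kactE !val_nxt; move: eta0 => z.
by case: i => -[|[|[]]] // ilt; case: x => [[] []]; rewrite /=; lra.
Qed.

(* Lengths grow by the factor 2 / eta per level for [len_cycle], in 012012...,
   and by the factor 2 for [len_const], in 000... *)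
Definition len_cycle : 'I_3 -> klein -> R := by_phase 2 (eta ^+ 2) eta 1.
Definition len_const (i : 'I_3) x : R := if kact i x then 1 else 2.

Lemma len_const_zeta i x : \sum_(y <- zeta1 i x) len_const i y <= 2 * len_const i x.
Proof.
rewrite /zeta1 /len_const; case E: (kact i x); rewrite !big_cons big_nil /=.
  by rewrite E; lra.
by rewrite kact_add E kact_partner /=; lra.
Qed.

(** The letter trivial at the current level is sent to b, c, d in some order, of total length eta^2
    + eta + 1 = 2 / eta by the equation of eta. The other two are doubled, and their length at the
    next level is eta times the present one. *)
Lemma len_cycle_zeta i x : \sum_(y <- zeta1 i x) len_cycle i y <= 2 / eta * len_cycle (nxt i) x.
Proof.
move: (eta0) (eta1) => z0 z1.
have e1 : 2 / eta * eta = 2 by rewrite mulfVK // gt_eqF.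
have e2 : 2 / eta = eta ^+ 2 + eta + 1.
  by apply: (mulIf (lt0r_neq0 eta0)); rewrite e1 -etaE; ring.
have e3 : 2 / eta * eta ^+ 2 = 2 * eta by rewrite expr2 mulrA e1.
have e4 : 0 <= eta ^+ 2 by rewrite exprn_ge0 // ltW.
have e5 : 2 <= 2 / eta by rewrite ler_pdivlMr //; lra.
rewrite /zeta1 /len_cycle /by_phase !kactE !val_nxt /partner.
by case: i => -[|[|[]]] // ilt; case: x => [[] []];
  rewrite /= !big_cons big_nil /= ?kactE ?val_nxt /= ?e1 ?e3; lra.
Qed.

Lemma len_cycle_bounds i x : eta ^+ 2 <= len_cycle i x <= len_const i x.
Proof.
move: (eta0) (eta1) => z0 z1; have h : eta ^+ 2 <= eta by rewrite expr2 ler_piMl // ltW.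
rewrite /len_cycle /len_const /by_phase.
case: eqP => [->|_].
  by rewrite kactE; case: i => -[|[|[]]] //= _; lra.
by case: (kact i x) => /=; last lra; case: ifP => _; lra.
Qed.

Lemma len_const_le2 i x : 0 <= len_const i x <= 2.
Proof. by rewrite /len_const; case: ifP => _; lra. Qed.
End Weights.

Lemma zeta_iterSr om n w : zeta_iter om n.+1 w = zeta_iter om n (zeta (om n) w).
Proof. by elim: n om => //= n IH om; rewrite IH. Qed.

(** * Growth along a pattern *)

Section Bounds.
Variables (R : realFieldType) (eta : R).
Hypotheses (eta0 : (0 < eta)%R) (eta1 : (eta < 1)%R)
  (etaE : (eta ^+ 3 + eta ^+ 2 + eta = 2)%R).
Variables (t : nat -> bool) (s : nat -> nat).
Hypothesis s_mono : forall n, s n <= s n.+1.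
Hypothesis s_up : forall n, ~~ t n -> t n.+1 -> s n < s n.+1.
Hypothesis t_inf : forall m, exists2 n, m <= n & t n.
Notation om := (pattern t).

Definition advances n := \sum_(i < n) t (i %/ 3).

Local Open Scope ring_scope.

Definition rate n : R := if t (n %/ 3)%N then eta else 1.

Lemma prod_rate n : \prod_(i < n) rate i = eta ^+ advances n.
Proof.
elim: n => [|n IH]; first by rewrite /advances !big_ord0.
rewrite /advances !big_ord_recr /= -/(advances n) IH exprD /rate.
by case: (t _); rewrite ?expr1 ?expr0.
Qed.

(* The last factor pays for the passages from [len_const] to [len_cycle]. *)
Definition length_scale n : R :=
  2 ^+ n * eta^-1 ^+ advances n * (2 / eta ^+ 2) ^+ (s (n %/ 3)%N).+1.

Lemma length_scale_gt0 n : 0 < length_scale n.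
Proof. by rewrite !mulr_gt0 ?exprn_gt0 ?invr_gt0 ?mulr_gt0 ?invr_gt0 ?exprn_gt0. Qed.

Let C := 2 / eta ^+ 2.

Lemma switch_cost_ge1 : 1 <= C.
Proof.
have e2 : eta ^+ 2 <= 1 by rewrite exprn_ile1 // ltW.
by rewrite ler_pdivlMr ?exprn_gt0 //; lra.
Qed.

Lemma s_div n : (s (n %/ 3) <= s (n.+1 %/ 3))%N.
Proof.
have [->//|e] := eqVneq (n.+1 %/ 3)%N (n %/ 3)%N.
by have -> : (n.+1 %/ 3 = (n %/ 3).+1)%N by lia.
Qed.

Lemma length_scaleS n : length_scale n * (2 * (rate n)^-1) <= length_scale n.+1.
Proof.
rewrite /length_scale -/C.
have -> : eta^-1 ^+ advances n.+1 = eta^-1 ^+ advances n * (rate n)^-1.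
  rewrite /advances big_ord_recr /= exprD; congr (_ * _).
  by rewrite /rate; case: (t _); rewrite ?expr1 ?expr0 ?invr1.
have h : C ^+ (s (n %/ 3)).+1 <= C ^+ (s (n.+1 %/ 3)).+1.
  by rewrite ler_weXn2l ?switch_cost_ge1 // ltnS s_div.
set a := eta^-1 ^+ advances n; set r := (rate n)^-1.
have -> : 2 ^+ n * a * C ^+ (s (n %/ 3)).+1 * (2 * r) =
  (2 ^+ n.+1 * (a * r)) * C ^+ (s (n %/ 3)).+1 by rewrite (exprS 2 n); ring.
apply: ler_wpM2l => //; rewrite !mulr_ge0 ?exprn_ge0 ?invr_ge0 ?(ltW eta0) //.
by rewrite /rate; case: ifP => _; rewrite ?ler01 ?(ltW eta0).
Qed.

Lemma length_scaleS_up n : ~~ t (n %/ 3)%N -> t (n.+1 %/ 3)%N ->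
  length_scale n * (2 * C) <= length_scale n.+1.
Proof.
move=> tn tn1; rewrite /length_scale -/C.
have -> : advances n.+1 = advances n by rewrite /advances big_ord_recr /= (negbTE tn) addn0.
have lt : (s (n %/ 3) < s (n.+1 %/ 3))%N.
  have [e|e] := eqVneq (n.+1 %/ 3)%N (n %/ 3)%N; first by rewrite e (negbTE tn) in tn1.
  have e' : (n.+1 %/ 3 = (n %/ 3).+1)%N by lia.
  by rewrite e'; apply: s_up; rewrite -?e'.
set a := eta^-1 ^+ advances n.
have -> : 2 ^+ n * a * C ^+ (s (n %/ 3)).+1 * (2 * C) =
  (2 ^+ n.+1 * a) * C ^+ (s (n %/ 3)).+2 by rewrite (exprS 2 n) (exprS C _.+1); ring.
apply: ler_wpM2l; first by rewrite mulr_ge0 ?exprn_ge0 // ?invr_ge0 (ltW eta0).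
by rewrite ler_weXn2l ?switch_cost_ge1.
Qed.

Definition letter_len n x : R :=
  if t (n %/ 3)%N then len_cycle eta (om n) x else len_const R (om n) x.

(** Passing from 012... to 000... is free since [len_cycle] is at most [len_const]. The opposite
    passage replaces lengths up to 2 by lengths down to eta^2, at the cost of one factor
    [2 / eta ^+ 2]. *)
Lemma letter_len_zeta n x :
  length_scale n * \sum_(y <- zeta1 (om n) x) letter_len n y <= length_scale n.+1 * letter_len n.+1 x.
Proof.
have sc := length_scale_gt0 n; have hA := len_cycle_bounds eta0 eta1.
have l0 i z : 0 <= len_cycle eta i z.
  by case/andP: (hA i z) => + _; apply: le_trans; rewrite exprn_ge0 // ltW.
have B0 (i : 'I_3) z : 0 <= len_const R i z by case/andP: (len_const_le2 R i z).
rewrite /letter_len pattern_next; case tn: (t (n %/ 3)%N).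
  apply: (@le_trans _ _ (length_scale n.+1 * len_cycle eta (nxt (om n)) x)).
    apply: le_trans (ler_wpM2r (l0 _ _) (length_scaleS n)).
    rewrite -[leRHS]mulrA; apply: ler_wpM2l; first exact: ltW.
    by rewrite /rate tn; exact: len_cycle_zeta.
  apply: ler_wpM2l; first exact/ltW/length_scale_gt0.
  by case: ifP => // _; case/andP: (hA (nxt (om n)) x).
case tn1: (t (n.+1 %/ 3)%N); last first.
  apply: le_trans (ler_wpM2r (B0 _ _) (length_scaleS n)).
  rewrite -[leRHS]mulrA; apply: ler_wpM2l; first exact: ltW.
  by rewrite /rate tn invr1 mulr1; exact: len_const_zeta.
apply: le_trans (ler_wpM2r (l0 _ _) (length_scaleS_up _ tn1)); last by rewrite tn.
rewrite -[leRHS]mulrA; apply: ler_wpM2l; first exact: ltW.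
apply: le_trans (len_const_zeta R _ _) _; rewrite -mulrA ler_wpM2l //.
case/andP: (hA (om n) x) => h1 _; apply: (@le_trans _ _ 2); first by case/andP: (len_const_le2 R (om n) x).
rewrite /C mulrAC ler_pdivlMr ?exprn_gt0 // ler_wpM2l //.
Qed.

Lemma size_zeta_iter n w :
  (size (zeta_iter om n w))%:R <= length_scale n * \sum_(x <- w) letter_len n x.
Proof.
elim: n w => [|n IH] w.
  rewrite /= -sum1_size natr_sum mulr_sumr; apply: ler_sum => x _.
  have e0 : 0 < eta ^+ 2 by rewrite exprn_gt0.
  have lx : eta ^+ 2 <= letter_len 0 x.
    case/andP: (len_cycle_bounds eta0 eta1 (om 0%N) x) => h1 h2.
    by rewrite /letter_len; case: ifP => _ //; exact: le_trans h2.
  have CX : C <= C ^+ (s (0 %/ 3)).+1 by rewrite exprS ler_peMr ?(le_trans ler01) ?switch_cost_ge1 // exprn_ege1 // switch_cost_ge1.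
  rewrite /length_scale -/C /advances big_ord0 !expr0 !mul1r.
  have : C * eta ^+ 2 <= C ^+ (s (0 %/ 3)).+1 * letter_len 0 x.
    by apply: ler_pM => //; [exact: le_trans switch_cost_ge1 | exact: ltW].
  by rewrite /C mulfVK ?gt_eqF // -/C; lra.
rewrite zeta_iterSr; apply: le_trans (IH _) _.
rewrite !mulr_sumr /zeta big_flatten big_map /=; apply: ler_sum => x _.
by rewrite -mulr_sumr; exact: letter_len_zeta.
Qed.

Lemma size_jump j : (size (jump om j))%:R <= 8 * length_scale j.
Proof.
rewrite /jump size_pairs -muln2 natrM; set x := jump_letter _.
have := size_zeta_iter j [:: x; x]; rewrite !big_cons big_nil addr0.
have l2 : letter_len j x <= 2.
  case/andP: (len_cycle_bounds eta0 eta1 (om j) x) => h1 h2.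
  case/andP: (len_const_le2 R (om j) x) => h3 h4.
  by rewrite /letter_len; case: ifP => _ //; exact: le_trans h4.
have : length_scale j * (letter_len j x + letter_len j x) <= length_scale j * (2 + 2).
  by apply: ler_wpM2l; [exact/ltW/length_scale_gt0 | exact: lerD].
lra.
Qed.

Lemma length_scale_double n : 2 * length_scale n <= length_scale n.+1.
Proof.
apply: le_trans (length_scaleS n); rewrite mulrC; apply: ler_wpM2l; first exact/ltW/length_scale_gt0.
rewrite ler_peMr // /rate; case: ifP => _; last by rewrite invr1.
by rewrite invf_ge1 // ltW.
Qed.

Lemma length_scale_mono m n : (m <= n)%N -> length_scale m <= length_scale n.
Proof.
move/subnKC => <-; elim: (n - m)%N => [|k IH]; first by rewrite addn0.
rewrite addnS; apply: le_trans IH _; apply: le_trans (length_scale_double _).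
by have := length_scale_gt0 (m + k); lra.
Qed.

Section Growth.
Variable F : finGroupType.

Lemma growth_upper : exists2 c : R, 0 < c & forall n r,
  eta ^+ advances n * (c * r%:R) <= 2 ^+ n ->
  (growth (letters F om) r <= #|{: option (klein * F)}|.+1 ^ (8 * 2 ^ n))%N.
Proof.
have [h1 [h2 h3]] := weights_ge1 eta0 eta1 etaE.
exists (1 - eta ^+ 3)^-1 => [|n r]; first by lra.
rewrite -prod_rate => hn.
apply: (@growth_letters_le F om R n r (fun i => contracting eta (om i)) rate) hn.
- by move=> i x; exact: contracting_ge0.
- by move=> i x y; exact: contracting_kmul.
- by move=> i; rewrite /rate; case: ifP => _; rewrite ?ler01 ?lexx ?(ltW eta0) ?(ltW eta1).
- move=> i x; rewrite pattern_next /rate; case tn: (t _); first exact: contracting_next.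
  rewrite mul1r; case: (kact _ _) => //=; rewrite lerD2r; exact: ler01.
- lra.
- by move=> x; exact: contracting_le.
Qed.

Variables k h : nat.
Hypothesis hk : (32 * k.+3 ^ 2 <= 2 ^ h)%N.

Definition free_levels n := [seq j <- iota n h.*2 | om j != ord_max].

(** By [pattern_sep] the letter 2 never occurs twice in a row. *)
Lemma size_free_levels n : (h <= size (free_levels n) <= h.*2)%N.
Proof.
rewrite /free_levels size_filter; apply/andP; split; last first.
  by apply: leq_trans (count_size _ _) _; rewrite size_iota.
elim: (h) n => [|h' IH] n //=.
have := @pattern_sep t n; have := IH n.+2; move: (count _ _) => c hc.
by case: (eqVneq (om n)) => [e /(_ e) ->|_ _] /=; lia.
Qed.

Lemma size_jumps js u m : all (fun j => j <= m)%N js ->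
  (size (jumps om js u))%:R <= (size js)%:R * (8 * length_scale m).
Proof.
have z0 : 0 <= 8 * length_scale m by rewrite mulr_ge0 // ltW // length_scale_gt0.
elim: js u => [|j js IH] u /=; first by rewrite mul0r.
case/andP=> jm /(IH (behead u)) {}IH.
rewrite size_cat natrD -[in leRHS]natr1 mulrDl mul1r addrC; apply: lerD => //.
case: ifP => // _; apply: le_trans (size_jump _) _.
by rewrite ler_wpM2l //; exact: length_scale_mono.
Qed.

Lemma size_spread n (u : bitsT free_levels n) :
  (size (spread om u))%:R <= (n + h.*2)%:R * (8 * length_scale (n + h.*2)).
Proof.
have z0 : 0 <= 8 * length_scale (n + h.*2) by rewrite mulr_ge0 // ltW // length_scale_gt0.
rewrite /spread size_cat natrD.
have l1 : all (fun j => j <= n + h.*2)%N (free_levels n).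
  by apply/allP => j; rewrite mem_filter mem_iota => /andP[_ /andP[_ /ltnW]].
have l2 : all (fun j => j <= n + h.*2)%N (iota 0 n).
  by apply/allP => j; rewrite mem_iota add0n => /andP[_ /ltnW jn]; rewrite (leq_trans jn) ?leq_addr.
apply: le_trans (lerD (size_jumps _ l1) (size_jumps _ l2)) _.
rewrite -mulrDl ler_wpM2r // -natrD ler_nat size_iota addnC leq_add2l.
by case/andP: (size_free_levels n).
Qed.

(** Each higher scale has half as many spreads, while [length_scale] at least doubles per level, so
    that none of the [n] scales costs more than the bound for the top one. *)
Lemma size_word n (d : jumpT free_levels n) e :
  (size (word om d e))%:R <=
  2 ^+ n + n%:R * ((n + h.*2)%:R * (8 * length_scale (n + h.*2))).
Proof.
elim: n d e => [|n IH] d e; first by rewrite mul0r addr0 expr0; case: (e).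
have -> : size (word om (levels := free_levels) (n := n.+1) d e) =
    (size (word om d.1.1 e.1) + (size (spread om d.1.2) + size (word om d.2 e.2)))%N.
  by rewrite /= !size_cat.
rewrite natrD natrD.
have h1 := IH d.1.1 e.1; have h2 := IH d.2 e.2; have h3 := size_spread d.1.2.
set a := (n + h.*2)%:R in h1 h2 h3 *; set z := length_scale (n + h.*2) in h1 h2 h3 *.
have a0 : 0 <= a by rewrite ler0n.
have z0 : 0 < z by exact: length_scale_gt0.
have zz : 2 * z <= length_scale (n.+1 + h.*2) by rewrite addSn; exact: length_scale_double.
set z' := length_scale _ in zz *.
have n0 : 0 <= n%:R :> R by rewrite ler0n.
have e1 : n%:R * (a * (8 * (2 * z))) <= n%:R * ((a + 1) * (8 * z')).
  rewrite ler_wpM2l // ler_pM //; rewrite ?lerDl ?ler01 //; lra.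
have e2 : a * (8 * z) <= (a + 1) * (8 * z').
  by rewrite ler_pM // ?lerDl ?ler01 //; lra.
have -> : (n.+1 + h.*2)%:R = a + 1 :> R by rewrite addSn -natr1.
rewrite exprS -[n.+1%:R]natr1.
have -> : (n%:R + 1) * ((a + 1) * (8 * z')) =
  n%:R * ((a + 1) * (8 * z')) + (a + 1) * (8 * z') by ring.
have e3 : n%:R * (a * (8 * z)) + n%:R * (a * (8 * z)) = n%:R * (a * (8 * (2 * z))) by ring.
lra.
Qed.

Lemma growth_lower (L : nat) :
  2 ^+ k.+3 + k.+3%:R * ((k.+3 + h.*2)%:R * (8 * length_scale (k.+3 + h.*2))) <= L%:R ->
  (2 ^ 2 ^ k <= growth (letters F om) L)%N.
Proof.
move=> hL.
have sL d e : (size (word om (levels := free_levels) (n := k.+3) d e) <= L)%N.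
  by rewrite -(ler_nat R); apply: le_trans (size_word _ _) hL.
pose f (p : jumpT free_levels k.+3 * lampT k.+3) :=
  word_val om (map (@pure_letter F) (word om (levels := free_levels) (n := k.+3) p.1 p.2)).
apply: (growth_ge_card (f := f)) => [p|P lab labP].
  by apply: word_val_ball; rewrite size_map.
(* [M] is a level of letter 2, the last one of a group of three, deeper than the words are long, as
   [probe] requires, and than all the jumps. *)
have [q qm tq] := t_inf (k + h.*2 + L + 5)%N.
pose M := (q * 3 + 2)%N.
have Mq : (M %/ 3 = q)%N by rewrite /M; lia.
apply: (@word_count om free_levels M k h P lab).
- by apply/eqP; rewrite pattern_max Mq tq /M; lia.
- move=> n; apply: sorted_filter; [exact: ltn_trans | exact: iota_ltn_sorted].
- move=> n j nk; rewrite mem_filter mem_iota => /andP[-> /andP[-> jn]].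
  by rewrite andbT /= /M; lia.
- by move=> n _; case/andP: (size_free_levels n).
- by rewrite /M; lia.
- exact: hk.
- by move=> d e; apply: leq_ltn_trans (sL d e) _; rewrite /M; lia.
move=> p p' /labP e v.
have lK (w : seq (option klein)) : map (omap fst) (map (@pure_letter F) w) = w.
  by rewrite -map_comp -[RHS]map_id; apply: eq_map => -[x|].
by have := congr1 (fun u => tact (val (wr_grp u)) v) e; rewrite !tact_word_val !lK.
Qed.
End Growth.
End Bounds.

(** * Blocks of prescribed density *)

Notation isqrt := PeanoNat.Nat.sqrt.

Lemma isqrtP n : (isqrt n) ^ 2 <= n < (isqrt n).+1 ^ 2.
Proof. by have := PeanoNat.Nat.sqrt_spec n (PeanoNat.Nat.le_0_l n); rewrite -!mulnn; lia. Qed.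

Lemma isqrt_uniq n k : k ^ 2 <= n < k.+1 ^ 2 -> isqrt n = k.
Proof.
move=> /andP[kn nk]; have /andP[h1 h2] := isqrtP n.
have sq_lt a b : a ^ 2 < b.+1 ^ 2 -> a <= b by rewrite ltn_exp2r.
apply/eqP; rewrite eqn_leq.
by rewrite (sq_lt _ _ (leq_ltn_trans h1 nk)) (sq_lt _ _ (leq_ltn_trans kn h2)).
Qed.

Lemma isqrtD m n : isqrt (m + n) <= isqrt m + isqrt n.
Proof. by apply/ssrnat.leP; exact: PeanoNat.Nat.sqrt_add_le. Qed.

Lemma isqrt_le n : isqrt n <= n.
Proof. by apply/ssrnat.leP; apply: PeanoNat.Nat.sqrt_le_lin; exact: PeanoNat.Nat.le_0_l. Qed.

Lemma isqrt_mono m n : m <= n -> isqrt m <= isqrt n.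
Proof. by move=> /ssrnat.leP h; apply/ssrnat.leP; exact: PeanoNat.Nat.sqrt_le_mono. Qed.

Lemma isqrtS n : isqrt n.+1 = isqrt n \/
  isqrt n.+1 = (isqrt n).+1 /\ n.+1 = (isqrt n).+1 ^ 2.
Proof.
have /andP[h1 h2] := isqrtP n.
have [e|e] := eqVneq n.+1 ((isqrt n).+1 ^ 2); [right | left].
  by split=> //; apply: isqrt_uniq; move: e; set s := (isqrt n).+1 => ->; rewrite leqnn ltn_exp2r ?ltnSn.
apply: isqrt_uniq; apply/andP; split; first exact: leq_trans h1 _.
by rewrite ltn_neqAle e h2.
Qed.

Lemma sqrnS k : k.+1 ^ 2 = k ^ 2 + (2 * k).+1.
Proof. by rewrite -!mulnn; lia. Qed.

Lemma triple_add2 k : 3 * k + 2 = ((2 * k).+1 + k).+1.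
Proof. by lia. Qed.

Section Density.
Variables (R : realFieldType) (theta : R).
Hypothesis theta01 : (0 <= theta <= 1)%R.
Local Open Scope ring_scope.

(* In the block [k^2, (k+1)^2) the first [theta (2k+1)] integers are chosen, and at
   least one, so that 2 occurs infinitely often in the pattern also for [theta = 0]. *)
Definition chosen (i : nat) : bool :=
  (i - isqrt i ^ 2)%N%:R <= theta * (2 * isqrt i).+1%:R.

Lemma chosen_square k : chosen (k ^ 2)%N.
Proof.
have e : isqrt (k ^ 2) = k by apply: isqrt_uniq; rewrite leqnn ltn_exp2r ?ltnSn.
rewrite /chosen e subnn.
by rewrite mulr_ge0 ?ler0n //; case/andP: theta01.
Qed.

Lemma chosen_inf m : exists2 n, (m <= n)%N & chosen n.
Proof. by exists (m ^ 2)%N; [nia | exact: chosen_square]. Qed.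

(** In a block the chosen integers come first, so a passage from not chosen to chosen occurs at a
    square: [isqrt] can serve as the counter [s] of these passages. *)
Lemma chosen_up n : ~~ chosen n -> chosen n.+1 -> (isqrt n < isqrt n.+1)%N.
Proof.
case: (isqrtS n) => [e|[-> _] //]; rewrite /chosen e -ltNge => h h'.
have := le_lt_trans h' h; rewrite ltr_nat.
lia.
Qed.

Definition chosen_count n := (\sum_(i < n) chosen i)%N.

(** [j] is the position in the current block: the count first follows [j], then stays near the quota
    theta (2k+1). Rounding up adds at most 1 per finished block, whence the [k] in the upper
    bounds. *)
Lemma chosen_countP n : let k := isqrt n in let T := (chosen_count n)%:R in
  let j := (n - k ^ 2)%N%:R in
  [/\ j <= T - theta * (k ^ 2)%:R \/ theta * (2 * k).+1%:R <= T - theta * (k ^ 2)%:R,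
      T - theta * (k ^ 2)%:R <= k%:R + j &
      T - theta * (k ^ 2)%:R <= k%:R + theta * (2 * k).+1%:R + 1].
Proof.
have /andP[t0 t1] := theta01.
elim: n => [|n /= [a b c]].
  rewrite /chosen_count big_ord0 (_ : isqrt 0 = 0)%N // (_ : 0 - 0 ^ 2 = 0)%N //.
  by rewrite !mulr0 subrr muln0; split; [left | |]; lra.
set k := isqrt n in a b c.
have /andP[kn _] := isqrtP n; rewrite -/k in kn.
set T := (chosen_count n)%:R in a b c.
set j := (n - k ^ 2)%N in a b c.
have TS : (chosen_count n.+1)%:R = T + (chosen n)%:R.
  by rewrite /chosen_count big_ord_recr /= natrD.
set q := theta * (k ^ 2)%:R in a b c; set m := theta * (2 * k).+1%:R in a c.
have chE : chosen n = (j%:R <= m) by [].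
have [a' b' c'] : [/\ j.+1%:R <= T + (chosen n)%:R - q \/ m <= T + (chosen n)%:R - q,
    T + (chosen n)%:R - q <= k%:R + j.+1%:R &
    T + (chosen n)%:R - q <= k%:R + m + 1].
  rewrite chE -natr1; case: (leP j%:R m) => jm /=; split; lra.
have [e|[e e']] := isqrtS n.
  by rewrite e -/k TS (_ : (n.+1 - k ^ 2)%N = j.+1) // subSn.
have jE : j = (2 * k)%N.
  by move: e'; rewrite sqrnS addnS => -[nE]; rewrite /j nE addKn.
rewrite e -/k TS e' subnn /=.
have -> : theta * (k.+1 ^ 2)%:R = q + m.
  by rewrite /q /m -mulrDr -natrD sqrnS.
have m1 : m <= (2 * k).+1%:R by rewrite /m ler_piMl ?ler0n.
have m0 : 0 <= theta * (2 * k.+1).+1%:R by rewrite mulr_ge0 ?ler0n.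
rewrite jE in a'; rewrite -[k.+1%:R]natr1.
by split; [left; case: a' | |]; lra.
Qed.

Lemma chosen_count_bounds n :
  theta * n%:R - (2 * isqrt n)%:R <= (chosen_count n)%:R <=
  theta * n%:R + (3 * isqrt n + 2)%:R.
Proof.
have /andP[t0 t1] := theta01.
have /= [a b c] := chosen_countP n; have /andP[h1 h2] := isqrtP n.
set k := isqrt n in a b c h1 h2 *.
have e1 : theta * (k ^ 2)%:R <= theta * n%:R by rewrite ler_wpM2l // ler_nat.
have e2 : theta * n%:R <= theta * (k ^ 2 + 2 * k)%:R.
  by rewrite ler_wpM2l // ler_nat; lia.
rewrite natrD mulrDr in e2.
have e3 : theta * (2 * k)%:R <= (2 * k)%:R by rewrite ler_piMl ?ler0n.
have e4 : theta * (2 * k).+1%:R <= (2 * k).+1%:R by rewrite ler_piMl ?ler0n.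
have e5 : 0 <= theta * (2 * k).+1%:R by rewrite mulr_ge0 ?ler0n.
have e6 : 0 <= (n - k ^ 2)%N%:R :> R by rewrite ler0n.
have e7 : (3 * k + 2)%:R = (2 * k).+1%:R + k%:R + 1 :> R.
  by rewrite -natrD natr1 triple_add2.
have k0 : 0 <= (2 * k)%:R :> R by rewrite ler0n.
by apply/andP; split; last lra; case: a => a; lra.
Qed.

Lemma advances_bounds n :
  theta * n%:R - (6 * isqrt n + 6)%:R <= (advances chosen n)%:R <=
  theta * n%:R + (9 * isqrt n + 8)%:R.
Proof.
have /andP[t0 t1] := theta01.
have [h1 h2] : (3 * chosen_count (n %/ 3) <= advances chosen n)%N /\
  (advances chosen n <= 3 * chosen_count (n %/ 3) + 2)%N.
  set q := (n %/ 3)%N.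
  have E m : advances chosen (3 * m)%N = (3 * chosen_count m)%N.
    elim: m => [|m IH]; first by rewrite /advances /chosen_count !big_ord0.
    have d0 : ((3 * m) %/ 3 = m)%N by lia.
    have d1 : ((3 * m).+1 %/ 3 = m)%N by lia.
    have d2 : ((3 * m).+2 %/ 3 = m)%N by lia.
    rewrite /chosen_count big_ord_recr -/(chosen_count m) mulnDr -IH.
    rewrite /advances mulnSr addn3 !big_ord_recr /= d0 d1 d2 -/(advances _ _).
    by move: (advances _ _) => A; case: (chosen m); lia.
  have mono a b : (advances chosen a <= advances chosen (a + b) <= advances chosen a + b)%N.
    elim: b => [|b /andP[IH1 IH2]]; first by rewrite !addn0 leqnn.
    have S : advances chosen (a + b).+1 = (advances chosen (a + b) + chosen ((a + b) %/ 3))%N.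
      by rewrite /advances big_ord_recr.
    by rewrite !addnS S; move: IH1 IH2; case: (chosen _); lia.
  have := mono (3 * q)%N (n %% 3)%N; rewrite E.
  have -> : (3 * q + n %% 3 = n)%N by rewrite /q; lia.
  by move=> /andP[-> h]; split=> //; have := ltn_mod n 3; lia.
have /andP[b1 b2] := chosen_count_bounds (n %/ 3).
have m1 : (isqrt (n %/ 3) <= isqrt n)%N by apply: isqrt_mono; lia.
rewrite -(ler_nat R) natrM in h1; rewrite -(ler_nat R) natrD natrM in h2.
have e1 : theta * n%:R <= theta * (3 * (n %/ 3) + 3)%:R by rewrite ler_wpM2l // ler_nat; lia.
have e2 : theta * (3 * (n %/ 3))%:R <= theta * n%:R by rewrite ler_wpM2l // ler_nat; lia.
rewrite natrD mulrDr !natrM in e1; rewrite !natrM in e2.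
rewrite -(ler_nat R) in m1.
have cst a b c : (a * b + c)%:R = a%:R * b%:R + c%:R :> R by rewrite natrD natrM.
rewrite natrM in b1; rewrite cst in b2; rewrite !cst.
by apply/andP; split; lra.
Qed.
End Density.

Local Open Scope classical_set_scope.
Local Open Scope ring_scope.
(** * The exponent *)

Section Limit.
Variable R : realType.
Implicit Types (beta : R) (g : nat -> nat).

Lemma ler_ln_pos (x y : R) : 0 < x -> x <= y -> ln x <= ln y.
Proof. by move=> x0 xy; rewrite ler_ln // posrE // (lt_le_trans x0). Qed.

Lemma ln_gt0_nat n : (1 < n)%N -> 0 < ln n%:R :> R.
Proof. by move=> n1; rewrite ln_gt0 // ltr1n. Qed.

Lemma near_ln (x : R) : \forall r \near \oo, (0 < r)%N /\ x <= ln r%:R.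
Proof.
exists (Num.truncn (expR x)).+1 => // r /= hr; split; first exact: leq_trans hr.
have /andP[_ h] := truncn_itv (expR_ge0 x).
rewrite -[leLHS]expRK; apply: ler_ln_pos; first exact: expR_gt0.
by apply/ltW/(lt_le_trans h); rewrite ler_nat.
Qed.

(** With [r] on a logarithmic scale, a bounded factor on [r], as in a change of generators, only
    alters [B]. *)
Definition growth_upper_at g (Q : nat) beta := exists B, forall n r,
  (0 < r)%N -> ln r%:R <= beta * n%:R - B -> (g r <= Q ^ (8 * 2 ^ n))%N.

Definition growth_lower_at g beta := exists B, forall k r,
  (0 < r)%N -> beta * k%:R + B <= ln r%:R -> (2 ^ 2 ^ k <= g r)%N.

Lemma lnln_upper g Q beta : 0 < beta -> (1 < Q)%N -> growth_upper_at g Q beta ->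
  exists C, \forall r \near \oo,
    ln (ln (g r)%:R) <= ln 2 / beta * ln r%:R + C :> R.
Proof.
move=> b0 Q1 [B hB].
have l2 : 0 < ln 2 :> R by rewrite ln_gt0_nat.
have lQ : 1 <= 8 * ln Q%:R :> R.
  have : ln 2 <= ln Q%:R :> R by apply: ler_ln_pos => //; rewrite ler_nat.
  have : 1 - 2^-1 <= ln 2 :> R.
    have := @le_ln1Dx R (2^-1 - 1); rewrite subrKC lnV ?posrE //.
    by move=> h; have := h ltac:(lra); lra.
  lra.
exists (ln 2 * (`|B| / beta + 1) + ln (8 * ln Q%:R)).
have [N _ hN] := near_ln 0; exists N => // r /hN /= [r0 x0].
set x := ln r%:R in x0 *.
pose y := (x + `|B|) / beta.
have y0 : 0 <= y by rewrite divr_ge0 ?addr_ge0 // ltW.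
have /andP[n1 n2] := truncn_itv y0; set n := (Num.truncn y).+1 in n2.
have hy : beta * y = x + `|B| by rewrite mulrC divfK // gt_eqF.
have hg : (g r <= Q ^ (8 * 2 ^ n))%N.
  apply: hB => //; rewrite -/x.
  have : beta * y <= beta * n%:R by rewrite ler_pM2l // ltW.
  have := ler_norm B; lra.
have yn : n%:R <= y + 1 by rewrite -natr1 lerD2r.
have bound : ln (ln (g r)%:R) <= ln 2 * n%:R + ln (8 * ln Q%:R) :> R.
  have nn : 0 <= ln 2 * n%:R + ln (8 * ln Q%:R) :> R.
    by apply: addr_ge0; [apply: mulr_ge0; [exact: ltW | exact: ler0n] | exact: ln_ge0].
  (* [ln] is 0 at 0, so both logarithms vanish when [g r <= 1]. *)
  have [g1|g1] := leP (g r) 1%N.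
    suff -> : ln (g r)%:R = 0 :> R by rewrite ln0.
    by case: (g r) g1 => [|[|m]] // _; [rewrite ln0 | rewrite ln1].
  have lg : 0 < ln (g r)%:R :> R by rewrite ln_gt0_nat.
  have : ln (g r)%:R <= (8 * ln Q%:R) * 2 ^+ n :> R.
    have : ln (g r)%:R <= ln (Q ^ (8 * 2 ^ n))%:R :> R.
      by apply: ler_ln_pos; rewrite ?ltr0n ?ler_nat // (leq_trans _ g1).
    have e : (8 * 2 ^ n)%:R = 8 * 2 ^+ n :> R by rewrite natrM natrX.
    have Q0 : 0 < Q%:R :> R by rewrite ltr0n ltnW.
    by rewrite (natrX R Q) (lnXn _ Q0) -[ln _ *+ _]mulr_natr e mulrA [ln _ * 8]mulrC.
  move/(ler_ln_pos lg); rewrite lnM ?posrE ?exprn_gt0 ?(lt_le_trans _ lQ) // lnXn // -[ln 2 *+ _]mulr_natr; lra.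
apply: le_trans bound _.
have : ln 2 * n%:R <= ln 2 * (y + 1) by rewrite ler_pM2l.
rewrite /y !mulrDr !mulrDl !mulr1 [ln 2 / beta * x]mulrAC !mulrA; lra.
Qed.

Lemma lnln_lower g beta : 0 < beta -> growth_lower_at g beta ->
  exists C, \forall r \near \oo,
    ln 2 / beta * ln r%:R - C <= ln (ln (g r)%:R) :> R.
Proof.
move=> b0 [B hB].
have l2 : 0 < ln 2 :> R by rewrite ln_gt0_nat.
exists (ln 2 * (`|B| / beta + 1) - ln (ln 2)).
have [N _ hN] := near_ln `|B|; exists N => // r /hN /= [r0 x0].
set x := ln r%:R in x0 *.
pose y := (x - `|B|) / beta.
have y0 : 0 <= y by rewrite divr_ge0 ?subr_ge0 // ltW.
have /andP[n1 n2] := truncn_itv y0; set n := Num.truncn y in n1 n2.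
have hy : beta * y = x - `|B| by rewrite mulrC divfK // gt_eqF.
have hg : (2 ^ 2 ^ n <= g r)%N.
  apply: hB => //; rewrite -/x.
  have : beta * n%:R <= beta * y by rewrite ler_pM2l.
  have := ler_norm B; lra.
have bound : ln 2 * n%:R + ln (ln 2) <= ln (ln (g r)%:R) :> R.
  have lb : 2 ^+ n * ln 2 <= ln (g r)%:R :> R.
    have : ln (2 ^ 2 ^ n)%:R <= ln (g r)%:R :> R.
      by apply: ler_ln_pos; rewrite ?ltr0n ?expn_gt0 // ler_nat.
    by rewrite natrX lnXn // -[ln 2 *+ _]mulr_natr natrX mulrC.
  have p : 0 < 2 ^+ n * ln 2 :> R by rewrite mulr_gt0 ?exprn_gt0.
  by have := ler_ln_pos p lb; rewrite lnM ?posrE ?exprn_gt0 // lnXn // -[ln 2 *+ _]mulr_natr.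
apply: le_trans bound.
have : ln 2 * (y - 1) <= ln 2 * n%:R by rewrite ler_pM2l // lerBlDr natr1 ltW.
rewrite /y !mulrDr !mulrDl !mulrN !mulNr !mulr1 [ln 2 / beta * x]mulrAC !mulrA; lra.
Qed.

Lemma exponent_limit g Q beta : 0 < beta -> (1 < Q)%N ->
  (forall b, 0 < b < beta -> growth_upper_at g Q b) ->
  (forall b, beta < b -> growth_lower_at g b) ->
  ((fun r => ln (ln (g r)%:R) / ln r%:R : R) @ \oo --> ln 2 / beta)%classic.
Proof.
move=> b0 Q1 hU hL; have l2 : 0 < ln 2 :> R by rewrite ln_gt0_nat.
set a := ln 2 / beta; have a0 : 0 < a by rewrite divr_gt0.
have ab : ln 2 / a = beta by rewrite /a invf_div mulrC divfK // gt_eqF.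
apply/cvgrPdist_le => e e0.
(* [a / 2] keeps [a - e1] positive; [e / 2] leaves the other half of [e] to the additive
   constants. *)
pose e1 := Num.min (e / 2) (a / 2).
have e10 : 0 < e1 by rewrite lt_min !divr_gt0.
have [e1e e1a] : e1 <= e / 2 /\ e1 <= a / 2 by rewrite !ge_min !lexx orbT; split.
have inv (b : R) : 0 < b -> ln 2 / (ln 2 / b) = b.
  by move=> h; rewrite invf_div mulrC divfK // gt_eqF.
have [C1 [N1 _ U]] : exists C, \forall r \near \oo,
    ln (ln (g r)%:R) <= (a + e1) * ln r%:R + C :> R.
  have p : 0 < ln 2 / (a + e1) by rewrite divr_gt0 // addr_gt0.
  have [|C hC] := @lnln_upper g Q (ln 2 / (a + e1)) p Q1.
    apply: hU; rewrite p /= -ab ltr_pM2l // ltf_pV2 ?posrE ?addr_gt0 //; lra.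
  by exists C; move: hC; rewrite inv // addr_gt0.
have [C2 [N2 _ L]] : exists C, \forall r \near \oo,
    (a - e1) * ln r%:R - C <= ln (ln (g r)%:R) :> R.
  have ae : 0 < a - e1 by lra.
  have p : 0 < ln 2 / (a - e1) by rewrite divr_gt0.
  have [|C hC] := @lnln_lower g (ln 2 / (a - e1)) p.
    apply: hL; rewrite -ab ltr_pM2l // ltf_pV2 ?posrE //; lra.
  by exists C; move: hC; rewrite inv.
have [N3 _ H] := near_ln (1 + 2 * (`|C1| + `|C2|) / e).
exists (maxn N1 (maxn N2 N3)) => // r /=; rewrite !geq_max => /and3P[r1 r2 r3].
have := U _ r1; have := L _ r2; have [_] := H _ r3.
rewrite /=; set x := ln r%:R; set f := ln (ln _) => h3 h2 h1.
have c1 := ler_norm C1; have c2 := ler_norm C2.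
have hx : 0 < x by apply: lt_le_trans h3; rewrite ltr_pwDl // divr_ge0 ?(ltW e0) // mulr_ge0 // addr_ge0.
have hxe : `|C1| + `|C2| <= e / 2 * x.
  have : 2 * (`|C1| + `|C2|) / e <= x by lra.
  rewrite ler_pdivrMr //; lra.
have n1 := normr_ge0 C1; have n2 := normr_ge0 C2.
have q1 : e1 * x <= e / 2 * x by rewrite ler_pM2r.
rewrite ler_distl; apply/andP; split.
  by rewrite lerBlDr ler_pdivrMr //; lra.
by rewrite -lerBlDr ler_pdivlMr //; lra.
Qed.
End Limit.

Section Final.
Variable R : realType.
Implicit Types (g : nat -> nat).

Lemma isqrt_pad k : let m := (k.+3 + (4 * isqrt k.+3 + 5).*2)%N in
  (m <= k + 21 + 8 * isqrt k)%N /\ (isqrt m <= 9 * isqrt k + 12)%N.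
Proof.
move=> m; have mk : (m <= k + 21 + 8 * isqrt k)%N.
  have : (isqrt k.+3 <= isqrt k + 1)%N by rewrite -addn3; exact: isqrtD.
  rewrite /m; move: (isqrt k) (isqrt k.+3) => a b; lia.
split=> //; apply: leq_trans (isqrt_mono mk) _.
apply: leq_trans (isqrtD _ _) _.
apply: leq_trans (leq_add (isqrtD _ _) (isqrt_le _)) _.
have -> : isqrt 21 = 4%N by [].
by move: (isqrt k) => a; lia.
Qed.

(** With s = isqrt k, 2^s >= s + 1 gives 2^(4s) >= (s+1)^4 >= k^2; the 5 provides the factor 32. *)
Lemma isqrt_exp k : (32 * k ^ 2 <= 2 ^ (4 * isqrt k + 5))%N.
Proof.
have /andP[_ /ltnW k1] := isqrtP k; move: (isqrt k) k1 => s k1.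
have k2 : (s.+1 <= 2 ^ s)%N by exact: ltn_expl.
rewrite expnD mulnC (_ : (2 ^ 5 = 32)%N) // leq_mul2r /=.
rewrite mulnC (_ : s * 4 = s * 2 * 2)%N; last by rewrite -mulnA.
rewrite expnM leq_exp2r // (leq_trans k1) // expnM leq_exp2r //.
Qed.

(** Expanding (2 e s - 1)^2 >= 0 gives s <= e s^2 + 1 / (4 e). *)
Lemma isqrt_sublinear (e : R) : 0 < e ->
  exists2 B, 0 <= B & forall n, (isqrt n)%:R <= e * n%:R + B.
Proof.
move=> e0; exists (4 * e)^-1 => [|n]; first by rewrite invr_ge0 mulr_ge0 // ltW.
have /andP[h _] := isqrtP n; rewrite -(ler_nat R) natrX in h.
set s := (isqrt n)%:R in h *.
have h1 : e * s ^+ 2 <= e * n%:R by rewrite ler_pM2l.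
have h2 : s <= e * s ^+ 2 + (4 * e)^-1; last by lra.
have e4 : 0 < 4 * e by rewrite mulr_gt0.
rewrite -(ler_pM2l e4) mulrDr divff ?gt_eqF //.
have := sqr_ge0 (2 * e * s - 1); rewrite !expr2; nra.
Qed.

Lemma growth_upper_at_mulr g g' Q beta c : (0 < c)%N ->
  (forall r, (g' r <= g (c * r))%N) ->
  growth_upper_at g Q (beta : R) -> growth_upper_at g' Q beta.
Proof.
move=> c0 gg [B hB]; exists (B + ln c%:R) => n r r0 hr.
apply: leq_trans (gg r) _; apply: hB; first by rewrite muln_gt0 c0.
by rewrite natrM lnM ?posrE ?ltr0n //; lra.
Qed.

Lemma growth_lower_at_mulr g g' beta c : (0 < c)%N -> 0 <= beta ->
  (forall r r', (c * r <= r')%N -> (g r <= g' r')%N) ->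
  growth_lower_at g (beta : R) -> growth_lower_at g' beta.
Proof.
move=> c0 b0 gg [B hB]; exists (Num.max B 0 + ln (2 * c)%:R) => k r r0 hr.
have c0' : (0 < 2 * c)%N by rewrite muln_gt0.
have bk : 0 <= beta * k%:R by rewrite mulr_ge0.
have B0 : 0 <= Num.max B 0 by rewrite le_max lexx orbT.
have B1 : B <= Num.max B 0 by rewrite le_max lexx.
have rc : (2 * c <= r)%N.
  rewrite -(ler_nat R) -ler_ln ?posrE ?ltr0n //; lra.
pose r' := (r %/ c)%N.
have rr' : (r <= 2 * c * r')%N.
  have := divn_eq r c; have := ltn_pmod r c0; rewrite -/r'.
  have : (0 < r')%N by rewrite divn_gt0 // (leq_trans _ rc) // leq_pmull.
  nia.
have r'0 : (0 < r')%N by case: (r') rr' => //; rewrite muln0; lia.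
apply: leq_trans (gg r' r _); last by rewrite mulnC leq_divM.
apply: hB => //.
have : ln r%:R <= ln (2 * c * r')%:R :> R by apply: ler_ln_pos; rewrite ?ltr0n ?ler_nat.
rewrite natrM lnM ?posrE ?ltr0n //; lra.
Qed.

Variables (eta theta : R) (F : finGroupType).
Hypotheses (eta0 : 0 < eta) (eta1 : eta < 1) (etaE : eta ^+ 3 + eta ^+ 2 + eta = 2).
Hypothesis theta01 : 0 <= theta <= 1.
Notation om := (pattern (chosen theta)).

(** Logarithm of the mean growth factor of lengths per level, (2 / eta)^theta 2^(1 - theta). *)
Definition level_rate : R := ln 2 - theta * ln eta.

Lemma ln_eta_lt0 : ln eta < 0.
Proof. by rewrite ln_lt0 // eta0. Qed.

Lemma ln2_gt0 : 0 < ln 2 :> R.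
Proof. exact: ln_gt0_nat. Qed.

Lemma level_rate_gt0 : 0 < level_rate.
Proof.
have /andP[t0 _] := theta01; have := ln2_gt0.
have : theta * ln eta <= 0 by rewrite mulr_ge0_le0 // ltW // ln_eta_lt0.
by rewrite /level_rate; lra.
Qed.

Lemma letters_upper_at b : b < level_rate ->
  growth_upper_at (growth (letters F om)) #|{: option (klein * F)}|.+1 b.
Proof.
move=> br; have [c c0 hc] := growth_upper eta0 eta1 etaE
  (chosen theta) F.
have le0 := ln_eta_lt0.
(* Chosen so that the density error 6 * isqrt n, multiplied by - ln eta, uses up exactly the gap
   [level_rate - b]. *)
pose e := (level_rate - b) / (6 * - ln eta).
have e0 : 0 < e by rewrite divr_gt0 ?subr_gt0 // mulr_gt0 // oppr_gt0.
have [B B0 hB] := isqrt_sublinear e0.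
exists ((6 * B + 6) * - ln eta + ln c) => n r r0 hr; apply: hc.
have r0' : 0 < r%:R :> R by rewrite ltr0n.
rewrite -ler_ln ?posrE ?exprn_gt0 ?mulr_gt0 ?exprn_gt0 //.
rewrite lnM ?posrE ?exprn_gt0 ?mulr_gt0 // lnM ?posrE // !lnXn //.
rewrite -[ln eta *+ _]mulr_natr -[ln 2 *+ _]mulr_natr.
have /andP[a1 _] := advances_bounds theta01 n.
have h1 : ln eta * (advances (chosen theta) n)%:R <=
    ln eta * (theta * n%:R - (6 * isqrt n + 6)%:R) by rewrite ler_wnM2l // ltW.
have h2 : (6 * isqrt n + 6)%:R = 6 * (isqrt n)%:R + 6 :> R by rewrite natrD natrM.
have h3 : - ln eta * (6 * (isqrt n)%:R + 6) <= - ln eta * (6 * (e * n%:R + B) + 6).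
  by rewrite ler_wpM2l ?oppr_ge0 ?(ltW le0) // lerD2r ler_pM2l.
have h4 : - ln eta * (6 * (e * n%:R)) = (level_rate - b) * n%:R.
  rewrite /e; field; rewrite ?oppr_eq0 lt_eqF //.
rewrite h2 in h1; rewrite /level_rate in h4 hr; lra.
Qed.

Lemma ln_nat_le_isqrt n : (0 < n)%N -> ln n%:R <= 2 * ((isqrt n)%:R + 1) :> R.
Proof.
move=> n0; have /andP[_ h] := isqrtP n.
have : ln n%:R <= ln ((isqrt n).+1 ^ 2)%:R :> R.
  by apply: ler_ln_pos; rewrite ?ltr0n // ler_nat ltnW.
rewrite natrX lnXn ?ltr0n // -[ln _ *+ _]mulr_natr.
have := @ln_sublinear R (isqrt n).+1%:R; rewrite ltr0n => /(_ isT).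
by rewrite -[(isqrt n).+1%:R]natr1; lra.
Qed.

Lemma ln_length_scale n : ln (length_scale eta (chosen theta) isqrt n) <=
  level_rate * n%:R + (9 * (isqrt n)%:R + 8) * - ln eta
  + ((isqrt n)%:R + 1) * ln (2 / eta ^+ 2).
Proof.
have c0 : 0 < 2 / eta ^+ 2 by rewrite divr_gt0 ?exprn_gt0.
have e0 : 0 < eta^-1 by rewrite invr_gt0.
rewrite /length_scale lnM ?posrE ?mulr_gt0 ?exprn_gt0 // lnM ?posrE ?exprn_gt0 //.
rewrite !lnXn // lnV ?posrE // -[ln 2 *+ _]mulr_natr -[- _ *+ _]mulr_natr.
rewrite -[ln (2 / _) *+ _]mulr_natr.
have le0 := ln_eta_lt0.
have /andP[_ a1] := advances_bounds theta01 n.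
have h1 : - ln eta * (advances (chosen theta) n)%:R <=
    - ln eta * (theta * n%:R + (9 * isqrt n + 8)%:R).
  by rewrite ler_wpM2l // oppr_ge0 ltW.
have h2 : (9 * isqrt n + 8)%:R = 9 * (isqrt n)%:R + 8 :> R by rewrite natrD natrM.
have lc : 0 <= ln (2 / eta ^+ 2) by apply: ln_ge0; exact: switch_cost_ge1.
have h3 : ln (2 / eta ^+ 2) * (isqrt (n %/ 3)).+1%:R <=
    ln (2 / eta ^+ 2) * ((isqrt n)%:R + 1).
  rewrite ler_wpM2l // natr1 ler_nat ltnS; apply: isqrt_mono; exact: leq_div.
rewrite h2 in h1; rewrite /level_rate; lra.
Qed.

Lemma length_scale_ge n : 2 ^+ n <= length_scale eta (chosen theta) isqrt n.
Proof.
rewrite /length_scale -mulrA ler_peMr ?exprn_ge0 // -[leLHS]mulr1.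
apply: ler_pM => //; apply: exprn_ege1; first by rewrite invf_ge1 // ltW.
exact: switch_cost_ge1.
Qed.

Lemma letters_lower_at b : level_rate < b -> growth_lower_at (growth (letters F om)) b.
Proof.
move=> br; have le0 := ln_eta_lt0; have rt := level_rate_gt0.
set lc := ln (2 / eta ^+ 2).
have lc0 : 0 <= lc by apply: ln_ge0; exact: switch_cost_ge1.
(* [C] and [D] gather the coefficient of [isqrt m] and the constant in the bound for ln (9 m^2 z),
   with z the length scale at [m]; after [isqrt_pad], [C1] is the coefficient of [isqrt k]. *)
pose C := 4 + 9 * - ln eta + lc.
pose D := 4 + ln 9 + 8 * - ln eta + lc.
have C0 : 0 < C by rewrite /C; lra.
pose C1 := level_rate * 8 + C * 9.
have C10 : 0 < C1 by rewrite addr_gt0 // mulr_gt0.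
pose e := (b - level_rate) / C1.
have e0 : 0 < e by rewrite divr_gt0 // subr_gt0.
have [B B0 hB] := isqrt_sublinear e0.
exists (level_rate * 21 + C * 12 + D + C1 * B) => k r r0 hr.
pose h := (4 * isqrt k.+3 + 5)%N; pose m := (k.+3 + h.*2)%N.
have [mk sm] := isqrt_pad k; rewrite -/h -/m in mk sm.
have hk : (32 * k.+3 ^ 2 <= 2 ^ h)%N by exact: isqrt_exp.
have s_mono n : (isqrt n <= isqrt n.+1)%N by exact: isqrt_mono.
have H := growth_lower eta0 eta1 etaE s_mono (@chosen_up _ _ theta01) (chosen_inf theta01) F hk.
apply: H.
rewrite -/m; set z := length_scale _ _ _ m.
have z0 : 0 < z by exact: length_scale_gt0.
have m0 : (0 < m)%N by [].
have m1 : 1 <= m%:R :> R by rewrite ler1n.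
have km : k.+3%:R <= m%:R :> R by rewrite ler_nat leq_addr.
apply: (@le_trans _ _ (9 * m%:R ^+ 2 * z)).
  have h1 : 2 ^+ k.+3 <= m%:R ^+ 2 * z.
    apply: (@le_trans _ _ (2 ^+ m)); first by rewrite ler_weXn2l ?leq_addr ?ler1n.
    by apply: le_trans (length_scale_ge m) _; rewrite ler_peMl ?(ltW z0) // exprn_ege1.
  have h2 : k.+3%:R * (m%:R * (8 * z)) <= m%:R * (m%:R * (8 * z)).
    apply: ler_wpM2r => //; apply: mulr_ge0; first exact: ler0n.
    by apply: mulr_ge0 => //; exact: ltW.
  have h3 : m%:R * (m%:R * (8 * z)) = 8 * (m%:R ^+ 2 * z) by ring.
  by rewrite -mulrA; lra.
have mp : 0 < m%:R :> R by rewrite ltr0n.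
have mp2 : 0 < m%:R ^+ 2 :> R by exact: exprn_gt0.
have mp9 : 0 < 9 * m%:R ^+ 2 :> R by exact: mulr_gt0.
have p9 : 0 < 9 * m%:R ^+ 2 * z by exact: mulr_gt0.
rewrite -ler_ln ?posrE ?ltr0n //; apply: le_trans hr.
have -> : ln (9 * m%:R ^+ 2 * z) = ln 9 + ln m%:R * 2 + ln z.
  by rewrite lnM ?posrE // lnM ?posrE // lnXn // -[ln _ *+ _]mulr_natr.
have h1 := ln_length_scale m; have h2 := ln_nat_le_isqrt m0; rewrite -/z -/lc in h1.
have {}sm : (isqrt m)%:R <= 9 * (isqrt k)%:R + 12 :> R.
  by rewrite -natrM -natrD ler_nat.
have {}mk : m%:R <= k%:R + 21 + 8 * (isqrt k)%:R :> R.
  by rewrite -natrM -!natrD ler_nat.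
have h3 : level_rate * m%:R <= level_rate * (k%:R + 21 + 8 * (isqrt k)%:R).
  by rewrite ler_pM2l.
have h4 : C * (isqrt m)%:R <= C * (9 * (isqrt k)%:R + 12) by rewrite ler_pM2l.
have h5 : C1 * (isqrt k)%:R <= C1 * (e * k%:R + B) by rewrite ler_pM2l.
have h6 : C1 * (e * k%:R) = (b - level_rate) * k%:R.
  by rewrite mulrA [C1 * e]mulrC /e divfK ?gt_eqF.
rewrite /C1 in h5 h6 *; rewrite /C in h4 h5 h6 *; rewrite /D; lra.
Qed.
End Final.

Lemma log_growth_exponent (R : realType) (F : finGroupType) (eta theta : R) :
  0 < eta -> eta < 1 -> eta ^+ 3 + eta ^+ 2 + eta = 2 -> 0 <= theta <= 1 ->
  has_log_growth_exponent (Gamma F (pattern (chosen theta)))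
    (ln 2 / (ln 2 - theta * ln eta)).
Proof.
move=> eta0 eta1 etaE t01; set om := pattern _.
have b0 : 0 < level_rate eta theta by exact: level_rate_gt0.
have gL := @generates_letters F om.
split; first by exists (letters F om).
move=> S gS; apply: (@exponent_limit R _ #|{: option (klein * F)}|.+1 (level_rate eta theta) b0).
- rewrite card_option !card_prod card_bool ltnS; exact: ltn0Sn.
- move=> b /andP[_ bb].
  have [c c0 hc] := growth_change S gL.
  apply: growth_upper_at_mulr c0 hc _. exact: (letters_upper_at F eta0 eta1 etaE t01 bb).
- move=> b bb; have [c c0 hc] := growth_change (letters F om) gS.
  apply: (growth_lower_at_mulr c0 (ltW (lt_trans b0 bb)) _ (letters_lower_at F eta0 eta1 etaE t01 bb)).
  move=> r r' rr; apply: leq_trans (hc r) _; apply: growth_le => u.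
  exact: word_ball_mono.
Qed.

Theorem theorem6p1 (R : realType) (F : finGroupType) (eta : R)
    (eta_root : root ('X^3 + 'X^2 + 'X - 2%:P) eta) :
  let alpha0 : R := ln 2 / (ln 2 - ln eta) in
  forall alpha : R, alpha0 <= alpha <= 1 ->
  exists omega : nat -> 'I_3, has_log_growth_exponent (Gamma F omega) alpha.
Proof.
move=> alpha0 alpha /andP[a0 a1].
have etaE : eta ^+ 3 + eta ^+ 2 + eta = 2.
  by move: eta_root; rewrite rootE !hornerE => /eqP; lra.
have eta0 : 0 < eta.
  rewrite ltNge; apply/negP => h; have : eta * (eta ^+ 2 + eta + 1) <= 0.
    by apply: mulr_le0_ge0 => //; nra.
  by rewrite !mulrDr mulr1 -exprS -expr2; lra.
have eta1 : eta < 1.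
  rewrite ltNge; apply/negP => h.
  have h2 : 1 <= eta ^+ 2 by exact: exprn_ege1.
  by have h3 : 1 <= eta ^+ 3 by [exact: exprn_ege1]; lra.
have l0 : ln eta < 0 by rewrite ln_lt0 // eta0.
have l2 : 0 < ln 2 :> R by exact: ln2_gt0.
have d0 : 0 < ln 2 - ln eta by lra.
have alpha_gt0 : 0 < alpha by apply: lt_le_trans a0; exact: divr_gt0.
(* The solution of alpha = ln 2 / (ln 2 - theta * ln eta), whose right side decreases from 1 at
   theta = 0 to [alpha0] at theta = 1. *)
pose theta := (ln 2 / alpha - ln 2) / - ln eta.
have theta_le1 : theta <= 1.
  rewrite ler_pdivrMr ?oppr_gt0 // mul1r lerBlDr ler_pdivrMr //.
  by move: a0; rewrite /alpha0 ler_pdivrMr //; lra.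
have theta_ge0 : 0 <= theta.
  apply: divr_ge0; last by rewrite oppr_ge0 ltW.
  by rewrite subr_ge0 ler_pdivlMr //; rewrite ger_pMr.
have -> : alpha = ln 2 / (ln 2 - theta * ln eta).
  have -> : ln 2 - theta * ln eta = ln 2 / alpha.
    rewrite /theta invrN mulrN mulNr opprK divfK ?lt_eqF //; ring.
  by rewrite invf_div mulrC divfK // gt_eqF.
exists (pattern (chosen theta)); apply: log_growth_exponent => //.
by rewrite theta_ge0.
Qed.
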